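(* For every partially ordered set $E$, the adjunction morphism $N(E)\to N_2c_2(N(E))$ is a weak equivalence of simplicial sets.
   Context: $N$ is the usual nerve. $2\text{-}\mathcal{C}at$ is the category of small strict $2$-categories and strict $2$-functors; $\Delta_m=\{0<\dots<m\}$. $\mathcal{O}_m^{\le2}$ (the $2$-truncation of Street's $m$-th oriental) is the $2$-category with objects $0,\dots,m$, whose category of arrows from $k$ to $l$ is the set of subsets $S\subset\{0,\dots,m\}$ with $\min S=k$, $\max S=l$, ordered by inclusion (empty if $l<k$); composition of $1$-arrows is union. An order-preserving map $\varphi:\Delta_p\to\Delta_q$ induces the $2$-functor $k\mapsto\varphi(k)$, $S\mapsto\varphi(S)$. The functor $N_2$ from $2\text{-}\mathcal{C}at$ to simplicial sets is $N_2(C)_m=\mathrm{Hom}_{2\text{-}\mathcal{C}at}(\mathcal{O}_m^{\le2},C)$, and $c_2$ is its left adjoint. Weak equivalences of simplicial sets are those of the Kan–Quillen model structure. *)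

(* Defs.v *)
From HB Require Import structures.
From mathcomp Require Import all_boot all_order boolp.
From Stdlib Require Import Relation_Operators.

Set Implicit Arguments.
Unset Strict Implicit.
Unset Printing Implicit Defensive.

Import Order.Theory.
Local Open Scope order_scope.

(* [ord m] is Delta_m = {0 < ... < m}; the maps of the simplex category are the
   order morphisms of the library. *)
Notation ord m := 'I_m.+1.

Lemma omorphism_ext d (T : porderType d) d' (T' : porderType d')
  (f g : {omorphism T -> T'}) : f =1 g -> f = g.
Proof.
case: f g => [f [[Hf]]] [g [[Hg]]] /= /funext fg.
by case: _ / fg Hg => Hg; rewrite (Prop_irrelevance Hf Hg).
Qed.

Definition omid d (T : porderType d) : {omorphism T -> T} := idfun.

Definition omcomp d (T : porderType d) d' (T' : porderType d')
    d'' (T'' : porderType d'')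
    (f : {omorphism T' -> T''}) (g : {omorphism T -> T'}) :
  {omorphism T -> T''} := f \o g.

Record sset := SSet {
  simplex :> nat -> Type;
  act : forall m n, {omorphism ord m -> ord n} -> simplex n -> simplex m;
  act_id : forall n (x : simplex n), act (omid _) x = x;
  act_comp : forall m n p (f : {omorphism ord n -> ord p})
    (g : {omorphism ord m -> ord n}) (x : simplex p),
    act (omcomp f g) x = act g (act f x) }.

Record smap (X Y : sset) := SMap {
  smap_fun :> forall n, X n -> Y n;
  smap_nat : forall m n (f : {omorphism ord m -> ord n}) (x : X n),
    smap_fun (act f x) = act f (smap_fun x) }.

Arguments smap_fun {X Y} _ {n} _.

Lemma smap_ext X Y (f g : smap X Y) : (forall n (x : X n), f n x = g n x) -> f = g.
Proof.
case: f g => f Hf [g Hg] /= fg.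
have {}fg : f = g by apply: functional_extensionality_dep => n; apply: funext.
by case: _ / fg Hg => Hg; rewrite (Prop_irrelevance Hf Hg).
Qed.

Definition smap_id (X : sset) : smap X X :=
  @SMap X X (fun n x => x) (fun _ _ _ _ => erefl).

Lemma smap_comp_subproof X Y Z (g : smap Y Z) (f : smap X Y)
  m n (u : {omorphism ord m -> ord n}) (x : X n) :
  g m (f m (act u x)) = act u (g n (f n x)).
Proof. by rewrite !smap_nat. Qed.

Definition smap_comp X Y Z (g : smap Y Z) (f : smap X Y) : smap X Z :=
  SMap (smap_comp_subproof g f).

(* The nerve of a partially ordered set seen as a category: the functors
   Delta_m -> E are the order morphisms. *)
Section Nerve.
Variables (d : Order.disp_t) (E : porderType d).

Definition nerve : sset.
Proof.
refine (@SSet (fun m => {omorphism ord m -> E}) (fun m n f x => omcomp x f) _ _).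
- by move=> n x; apply: omorphism_ext.
- by move=> m n p f g x; apply: omorphism_ext.
Defined.

End Nerve.

Definition stdsimplex (n : nat) : sset := nerve (ord n).

Definition sprod (X Y : sset) : sset.
Proof.
refine (@SSet (fun m => (X m * Y m)%type)
              (fun m n f z => (act f z.1, act f z.2)) _ _).
- by move=> n [x y]; rewrite !act_id.
- by move=> m n p f g [x y]; rewrite !act_comp.
Defined.

(* The k-th horn of Delta^n: the simplices whose vertices together with k do
   not exhaust Delta_n. *)
Definition in_horn n (k : ord n) m (a : stdsimplex n m) : Prop :=
  exists2 j : ord n, j != k & forall i, a i != j.

Lemma in_horn_act n (k : ord n) m p (f : {omorphism ord m -> ord p})
  (a : stdsimplex n p) : in_horn k a -> in_horn k (act f a).
Proof. by case=> j jk Ha; exists j => // i /=; apply: Ha. Qed.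

Definition horn n (k : ord n) : sset.
Proof.
refine (@SSet (fun m => {a : stdsimplex n m | in_horn k a})
  (fun m p f a => exist _ (act f (sval a)) (in_horn_act f (svalP a))) _ _).
- by move=> m [a Ha]; apply: eq_exist; apply: act_id.
- by move=> m p q f g [a Ha]; apply: eq_exist; apply: act_comp.
Defined.

(* Horns exist in dimensions at least one, hence n.+1. *)
Definition kan_complex (K : sset) : Prop :=
  forall n (k : ord n.+1) (f : smap (horn k) K),
  exists g : smap (stdsimplex n.+1) K,
  forall m (a : horn k m), g m (sval a) = f m a.

Definition const_simplex n m (k : ord n) : stdsimplex n m.
Proof.
refine (@Order.OrderMorphism.Pack _ _ _ _ (fun _ => k) _).
by constructor; constructor=> x y _; apply: lexx.
Defined.

Definition elementary_homotopy X Y (f g : smap X Y) : Prop :=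
  exists h : smap (sprod X (stdsimplex 1)) Y,
  forall n (x : X n),
    h n (x, const_simplex n (@ord0 1)) = f n x /\
    h n (x, const_simplex n (@ord_max 1)) = g n x.

(* Same class in pi_0 of the simplicial mapping space Map(X, Y). *)
Definition homotopic X Y : smap X Y -> smap X Y -> Prop :=
  clos_refl_sym_trans _ (@elementary_homotopy X Y).

(* Weak equivalences of the Kan-Quillen model structure, as defined by
   Joyal-Tierney, by Cisinski and in Kerodon: the maps f : X -> Y such that
   pi_0 Map(Y, K) -> pi_0 Map(X, K) is a bijection for every Kan complex K. *)
Definition weak_equivalence X Y (f : smap X Y) : Prop :=
  forall K : sset, kan_complex K ->
  (forall g h : smap Y K,
     homotopic (smap_comp g f) (smap_comp h f) -> homotopic g h) /\
  (forall g : smap X K, exists h : smap Y K, homotopic (smap_comp h f) g).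

(* Globular presentation of small strict 2-categories: a set of objects, a set
   of 1-arrows and a set of 2-arrows.  The compositions are partial operations,
   taking a proof of composability, and are written in diagrammatic order.
   In an axiom every composability proof is quantified over: this makes no
   difference, by proof irrelevance, and avoids having to derive it. *)
Record twocat := TwoCat {
  ob : Type;
  ar : Type;
  ce : Type;
  src : ar -> ob;
  tgt : ar -> ob;
  dom : ce -> ar;
  cod : ce -> ar;
  src_cod : forall a, src (cod a) = src (dom a);
  tgt_cod : forall a, tgt (cod a) = tgt (dom a);

  id1 : ob -> ar;
  comp : forall f g, tgt f = src g -> ar;
  src_id1 : forall x, src (id1 x) = x;
  tgt_id1 : forall x, tgt (id1 x) = x;
  src_comp : forall f g e, src (@comp f g e) = src f;
  tgt_comp : forall f g e, tgt (@comp f g e) = tgt g;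
  comp1f : forall f e, @comp (id1 (src f)) f e = f;
  compf1 : forall f e, @comp f (id1 (tgt f)) e = f;
  compA : forall f g h e1 e2 e3 e4,
    @comp f (@comp g h e1) e2 = @comp (@comp f g e3) h e4;

  id2 : ar -> ce;
  vcomp : forall a b, cod a = dom b -> ce;
  dom_id2 : forall f, dom (id2 f) = f;
  cod_id2 : forall f, cod (id2 f) = f;
  dom_vcomp : forall a b e, dom (@vcomp a b e) = dom a;
  cod_vcomp : forall a b e, cod (@vcomp a b e) = cod b;
  vcomp1a : forall a e, @vcomp (id2 (dom a)) a e = a;
  vcompa1 : forall a e, @vcomp a (id2 (cod a)) e = a;
  vcompA : forall a b c e1 e2 e3 e4,
    @vcomp a (@vcomp b c e1) e2 = @vcomp (@vcomp a b e3) c e4;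

  hcomp : forall a b, tgt (dom a) = src (dom b) -> ce;
  dom_hcomp : forall a b e e', dom (@hcomp a b e) = @comp (dom a) (dom b) e';
  cod_hcomp : forall a b e e', cod (@hcomp a b e) = @comp (cod a) (cod b) e';
  hcomp1a : forall a e, @hcomp (id2 (id1 (src (dom a)))) a e = a;
  hcompa1 : forall a e, @hcomp a (id2 (id1 (tgt (dom a)))) e = a;
  hcompA : forall a b c e1 e2 e3 e4,
    @hcomp a (@hcomp b c e1) e2 = @hcomp (@hcomp a b e3) c e4;

  hcomp_id2 : forall f g e e', @hcomp (id2 f) (id2 g) e = id2 (@comp f g e');
  interchange : forall a a' b b' e1 e2 e3 e4 e5 e6,
    @hcomp (@vcomp a a' e1) (@vcomp b b' e2) e3 =
    @vcomp (@hcomp a b e4) (@hcomp a' b' e5) e6 }.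

Record twofun (C D : twocat) := TwoFun {
  fob : ob C -> ob D;
  far : ar C -> ar D;
  fce : ce C -> ce D;
  far_src : forall f, src (far f) = fob (src f);
  far_tgt : forall f, tgt (far f) = fob (tgt f);
  fce_dom : forall a, dom (fce a) = far (dom a);
  fce_cod : forall a, cod (fce a) = far (cod a);
  far_id1 : forall x, far (id1 x) = id1 (fob x);
  far_comp : forall f g e e', far (@comp C f g e) = @comp D (far f) (far g) e';
  fce_id2 : forall f, fce (id2 f) = id2 (far f);
  fce_vcomp : forall a b e e', fce (@vcomp C a b e) = @vcomp D (fce a) (fce b) e';
  fce_hcomp : forall a b e e', fce (@hcomp C a b e) = @hcomp D (fce a) (fce b) e' }.

Lemma twofun_ext C D (F G : twofun C D) :
  fob F =1 fob G -> far F =1 far G -> fce F =1 fce G -> F = G.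
Proof.
case: F G => F0 F1 F2 ? ? ? ? ? ? ? ? ? [G0 G1 G2 ? ? ? ? ? ? ? ? ?] /=.
move=> /funext e0 /funext e1 /funext e2; subst G0 G1 G2.
by congr TwoFun; apply: Prop_irrelevance.
Qed.

Definition twofun_id (C : twocat) : twofun C C.
Proof.
refine (@TwoFun C C id id id _ _ _ _ _ _ _ _ _) => //.
- by move=> f g e e'; rewrite (Prop_irrelevance e e').
- by move=> f g e e'; rewrite (Prop_irrelevance e e').
- by move=> f g e e'; rewrite (Prop_irrelevance e e').
Defined.

Definition twofun_comp C D E (G : twofun D E) (F : twofun C D) : twofun C E.
Proof.
refine (@TwoFun C E (fob G \o fob F) (far G \o far F) (fce G \o fce F)
  _ _ _ _ _ _ _ _ _) => /=.
- by move=> f; rewrite !far_src.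
- by move=> f; rewrite !far_tgt.
- by move=> f; rewrite !fce_dom.
- by move=> f; rewrite !fce_cod.
- by move=> f; rewrite !far_id1.
- move=> f g e e'; have e0 : tgt (far F f) = src (far F g).
    by rewrite far_tgt far_src e.
  by rewrite (far_comp e e0) (far_comp e0 e').
- by move=> f; rewrite !fce_id2.
- move=> f g e e'; have e0 : cod (fce F f) = dom (fce F g).
    by rewrite fce_dom fce_cod e.
  by rewrite (fce_vcomp e e0) (fce_vcomp e0 e').
- move=> f g e e'; have e0 : tgt (dom (fce F f)) = src (dom (fce F g)).
    by rewrite !fce_dom far_tgt far_src e.
  by rewrite (fce_hcomp e e0) (fce_hcomp e0 e').
Defined.

Section Oriental.
Variable m : nat.

(* The 1-arrows of the truncated oriental, from osrc to otgt: the subsets oset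
   with minimum osrc and maximum otgt.  Between two parallel ones there is a
   single 2-arrow when the first is included in the second. *)
Record oarrow := OArrow {
  osrc : ord m;
  otgt : ord m;
  oset : {set ord m};
  osrc_in : osrc \in oset;
  otgt_in : otgt \in oset;
  osrc_min : forall i, i \in oset -> osrc <= i;
  otgt_max : forall i, i \in oset -> i <= otgt }.

Lemma oarrow_ext (S T : oarrow) : oset S = oset T -> S = T.
Proof.
case: S T => k l S kS lS Sk Sl [k' l' S' kS' lS' Sk' Sl'] /= eS; subst S'.
have ek : k = k' by apply/le_anti; rewrite Sk // Sk'.
have el : l = l' by apply/le_anti; rewrite Sl' // Sl.
by subst k' l'; congr OArrow; apply: Prop_irrelevance.
Qed.

Record ocell := OCell {
  odom : oarrow;
  ocod : oarrow;
  ocell_src : osrc ocod = osrc odom;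
  ocell_tgt : otgt ocod = otgt odom;
  ocell_sub : oset odom \subset oset ocod }.

Lemma ocell_ext (a b : ocell) : odom a = odom b -> ocod a = ocod b -> a = b.
Proof.
case: a b => S T ? ? ? [S' T' ? ? ?] /= eS eT; subst S' T'.
by congr OCell; apply: Prop_irrelevance.
Qed.

Definition oid1 (k : ord m) : oarrow.
Proof.
by apply: (@OArrow k k [set k]) => [||i|i]; rewrite ?inE // => /eqP->.
Defined.

Definition ocomp (S T : oarrow) (e : otgt S = osrc T) : oarrow.
Proof.
apply: (@OArrow (osrc S) (otgt T) (oset S :|: oset T)) => [||i|i]; rewrite inE.
- by rewrite osrc_in.
- by rewrite otgt_in orbT.
- case/orP=> [|/osrc_min]; first exact: osrc_min.
  by apply: le_trans; rewrite -e; apply/osrc_min/otgt_in.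
- case/orP=> [/otgt_max iS|]; last exact: otgt_max.
  by apply: (le_trans iS); rewrite e; apply/otgt_max/osrc_in.
Defined.

Definition oid2 (S : oarrow) : ocell := @OCell S S erefl erefl (subxx _).

Definition ovcomp (a b : ocell) (e : ocod a = odom b) : ocell.
Proof.
apply: (@OCell (odom a) (ocod b)).
- by rewrite ocell_src -e ocell_src.
- by rewrite ocell_tgt -e ocell_tgt.
- by apply: (subset_trans (ocell_sub a)); rewrite e ocell_sub.
Defined.

Lemma ohcomp_subproof (a b : ocell) :
  otgt (odom a) = osrc (odom b) -> otgt (ocod a) = osrc (ocod b).
Proof. by rewrite ocell_src ocell_tgt. Qed.

Definition ohcomp (a b : ocell) (e : otgt (odom a) = osrc (odom b)) : ocell.
Proof.
apply: (@OCell (ocomp e) (ocomp (ohcomp_subproof e))) => /=.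
- exact: ocell_src.
- exact: ocell_tgt.
- exact: setUSS (ocell_sub a) (ocell_sub b).
Defined.

Definition oriental : twocat.
Proof.
refine (@TwoCat (ord m) oarrow ocell osrc otgt odom ocod ocell_src ocell_tgt
  oid1 ocomp _ _ _ _ _ _ _
  oid2 ovcomp _ _ _ _ _ _ _
  ohcomp _ _ _ _ _ _ _) => //.
- move=> S e; apply: oarrow_ext => /=.
  by apply/setUidPr; rewrite sub1set osrc_in.
- move=> S e; apply: oarrow_ext => /=.
  by apply/setUidPl; rewrite sub1set otgt_in.
- by move=> *; apply: oarrow_ext; rewrite /= setUA.
- by move=> *; apply: ocell_ext.
- by move=> *; apply: ocell_ext.
- by move=> *; apply: ocell_ext.
- by move=> *; apply: oarrow_ext.
- by move=> *; apply: oarrow_ext.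
- move=> a e; apply: ocell_ext; apply: oarrow_ext => /=.
    by apply/setUidPr; rewrite sub1set osrc_in.
  by apply/setUidPr; rewrite sub1set -ocell_src osrc_in.
- move=> a e; apply: ocell_ext; apply: oarrow_ext => /=.
    by apply/setUidPl; rewrite sub1set otgt_in.
  by apply/setUidPl; rewrite sub1set -ocell_tgt otgt_in.
- by move=> *; apply: ocell_ext; apply: oarrow_ext; rewrite /= setUA.
- by move=> *; apply: ocell_ext; apply: oarrow_ext.
- by move=> *; apply: ocell_ext; apply: oarrow_ext.
Defined.

End Oriental.

Section OrientalMap.
Variables (p q : nat) (f : {omorphism ord p -> ord q}).

Definition oarrow_map (S : oarrow p) : oarrow q.
Proof.
apply: (@OArrow q (f (osrc S)) (f (otgt S)) (f @: oset S)).
- exact/imset_f/osrc_in.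
- exact/imset_f/otgt_in.
- by move=> _ /imsetP[i iS ->]; apply/omorph_le/osrc_min.
- by move=> _ /imsetP[i iS ->]; apply/omorph_le/otgt_max.
Defined.

Definition ocell_map (a : ocell p) : ocell q.
Proof.
apply: (@OCell q (oarrow_map (odom a)) (oarrow_map (ocod a))) => /=.
- by rewrite ocell_src.
- by rewrite ocell_tgt.
- exact/imsetS/ocell_sub.
Defined.

Definition oriental_map : twofun (oriental p) (oriental q).
Proof.
refine (@TwoFun (oriental p) (oriental q) f oarrow_map ocell_map
  _ _ _ _ _ _ _ _ _) => //.
- by move=> k; apply: oarrow_ext; rewrite /= imset_set1.
- by move=> *; apply: oarrow_ext; rewrite /= imsetU.
- by move=> *; apply: ocell_ext.
- by move=> *; apply: ocell_ext.
- by move=> *; apply: ocell_ext; apply: oarrow_ext; rewrite /= imsetU.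
Defined.

End OrientalMap.

Definition N2 (C : twocat) : sset.
Proof.
refine (@SSet (fun m => twofun (oriental m) C)
  (fun m n f x => twofun_comp x (oriental_map f)) _ _).
- move=> n x; apply: twofun_ext => //= a; congr (_ x _).
    by apply: oarrow_ext; rewrite /= imset_id.
  by apply: ocell_ext; apply: oarrow_ext; rewrite /= imset_id.
- move=> m n p f g x; apply: twofun_ext => //= a; congr (_ x _).
    by apply: oarrow_ext; rewrite /= imset_comp.
  by apply: ocell_ext; apply: oarrow_ext; rewrite /= imset_comp.
Defined.

Definition N2_map C D (F : twofun C D) : smap (N2 C) (N2 D).
Proof.
refine (@SMap (N2 C) (N2 D) (fun n x => twofun_comp F x) _).
by move=> m n f x; apply: twofun_ext.
Defined.

(* A left adjoint functor of N_2 together with the unit of the adjunction, whose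
   components are universal arrows to N_2. *)
Record left_adjoint_N2 := LeftAdjointN2 {
  ladj :> sset -> twocat;
  ladj_map : forall X Y, smap X Y -> twofun (ladj X) (ladj Y);
  ladj_map_id : forall X, ladj_map (smap_id X) = twofun_id (ladj X);
  ladj_map_comp : forall X Y Z (g : smap Y Z) (f : smap X Y),
    ladj_map (smap_comp g f) = twofun_comp (ladj_map g) (ladj_map f);
  adj_unit : forall X, smap X (N2 (ladj X));
  adj_unit_nat : forall X Y (f : smap X Y),
    smap_comp (N2_map (ladj_map f)) (adj_unit X) = smap_comp (adj_unit Y) f;
  adj_unit_universal : forall X D (f : smap X (N2 D)),
    exists! F : twofun (ladj X) D, smap_comp (N2_map F) (adj_unit X) = f }.

(* The cells of the 2-category freely generated by X are classes of formal
   composites of cells of the orientals indexed by the simplices of X; such a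
   composite is legitimate, and two of them are identified, when this is so for
   their values in every 2-category D, along every simplicial map X -> N_2(D).
   [quot] is the resulting quotient of a set of terms, for a denotation [den]
   into a family of sets indexed by these pairs. *)
Section TermQuotient.
Variables (I : Type) (V : I -> Type) (T : Type).
Variable den : forall i, T -> V i -> Prop.
Hypothesis den_fun : forall i t v w, den t v -> den t w -> v = w :> V i.

Definition quot : Type :=
  {P : T -> Prop | exists t, (forall i, exists v : V i, den t v) /\
     P = (fun u => forall i (v : V i), den t v <-> den u v)}.

Lemma quot_ev_ex (q : quot) i :
  exists v : V i, forall t, sval q t -> den t v.
Proof.
case: q => P /= [t [Ht ->]]; have [v tv] := Ht i.
by exists v => u /(_ i v)[+ _]; apply.
Qed.

Definition ev (q : quot) i : V i := sval (cid (quot_ev_ex q i)).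

Lemma ev_rep (q : quot) : exists t, forall i, den t (ev q i).
Proof.
have [t qt] : exists t, sval q t by case: q => P /= [t [_ ->]]; exists t.
by exists t => i; rewrite /ev; case: cid => v /= /(_ t qt).
Qed.

Lemma ev_inj (q r : quot) : (forall i, ev q i = ev r i) -> q = r.
Proof.
move=> qr.
have key (s : quot) : sval s = fun t => forall i, den t (ev s i).
  apply: funext => t; apply: propext; split=> [st i|].
    by rewrite /ev; case: cid => v /= /(_ t st).
  case: s => P /= [u [Hu eP]] st; rewrite eP => i v.
  have := st i; rewrite /ev; case: cid => w /= + tw.
  move=> /(_ u); rewrite eP => /(_ (fun _ _ => iff_refl _)) uw.
  by split=> [/(den_fun uw) <-|/(den_fun tw) <-].
case: q r qr (key q) (key r) => P HP [Q HQ] qr /= kP kQ.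
apply: eq_exist; rewrite kP kQ; apply: funext => t.
by apply: propext; split=> H i; rewrite (qr, =^~ qr).
Qed.

Definition glued (v : forall i, V i) : Prop := exists t, forall i, den t (v i).

Lemma glue_subproof v : glued v -> exists q : quot, forall i, ev q i = v i.
Proof.
case=> t Ht.
have H : exists u, (forall i, exists v : V i, den u v) /\
   (fun w => forall i (v : V i), den t v <-> den w v) =
   (fun w => forall i (v : V i), den u v <-> den w v).
  by exists t; split=> // i; exists (v i).
exists (exist _ (fun w => forall i (v : V i), den t v <-> den w v) H) => i.
rewrite /ev; case: cid => w /= /(_ t) tw.
exact: (den_fun (tw (fun _ _ => iff_refl _)) (Ht i)).
Qed.

Definition glue v (H : glued v) : quot := sval (cid (glue_subproof H)).

Lemma ev_glue v (H : glued v) i : ev (glue H) i = v i.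
Proof. by rewrite /glue; case: cid. Qed.

End TermQuotient.

Section CompEq.
Variable C : twocat.

Lemma comp_eq (f f' g g' : ar C) e e' :
  f = f' -> g = g' -> @comp C f g e = @comp C f' g' e'.
Proof. by move=> ef eg; subst; rewrite (Prop_irrelevance e e'). Qed.

Lemma vcomp_eq (f f' g g' : ce C) e e' :
  f = f' -> g = g' -> @vcomp C f g e = @vcomp C f' g' e'.
Proof. by move=> ef eg; subst; rewrite (Prop_irrelevance e e'). Qed.

Lemma hcomp_eq (f f' g g' : ce C) e e' :
  f = f' -> g = g' -> @hcomp C f g e = @hcomp C f' g' e'.
Proof. by move=> ef eg; subst; rewrite (Prop_irrelevance e e'). Qed.

End CompEq.

Section FreeTwocat.
Variable X : sset.

Inductive term0 : Type := Gen0 m (x : X m) (k : ob (oriental m)).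

Inductive term1 : Type :=
| Gen1 m (x : X m) (S : ar (oriental m))
| Id1 of term0
| Comp of term1 & term1.

Inductive term2 : Type :=
| Gen2 m (x : X m) (a : ce (oriental m))
| Id2 of term1
| VComp of term2 & term2
| HComp of term2 & term2.

Record model := Model { model_cat :> twocat; model_map : smap X (N2 model_cat) }.

Definition val0 (D : model) (t : term0) : ob D :=
  let: Gen0 m x k := t in fob (model_map D m x) k.

Definition den0 (D : model) (t : term0) (v : ob D) : Prop := v = val0 D t.

Fixpoint den1 (D : model) (t : term1) (v : ar D) : Prop :=
  match t with
  | Gen1 m x s => v = far (model_map D m x) s
  | Id1 t => v = id1 (val0 D t)
  | Comp t u => exists a b e, [/\ den1 t a, den1 u b & v = @comp D a b e]
  end.

Fixpoint den2 (D : model) (t : term2) (v : ce D) : Prop :=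
  match t with
  | Gen2 m x a => v = fce (model_map D m x) a
  | Id2 t => exists2 a, den1 t a & v = id2 a
  | VComp t u => exists a b e, [/\ den2 t a, den2 u b & v = @vcomp D a b e]
  | HComp t u => exists a b e, [/\ den2 t a, den2 u b & v = @hcomp D a b e]
  end.

Lemma den0_fun D t v w : @den0 D t v -> den0 t w -> v = w.
Proof. by move=> -> ->. Qed.

Lemma den1_fun D t v w : @den1 D t v -> den1 t w -> v = w.
Proof.
elim: t v w => [m x S|t|t IHt u IHu] v w /=; [by move=> -> ->|by move=> -> ->|].
move=> [a [b [e [ta ub ->]]]] [a' [b' [e' [ta' ub' ->]]]].
by apply: comp_eq; [exact: IHt|exact: IHu].
Qed.

Lemma den2_fun D t v w : @den2 D t v -> den2 t w -> v = w.
Proof.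
elim: t v w => [m x a|t|t IHt u IHu|t IHt u IHu] v w /=.
- by move=> -> ->.
- by move=> [a ta ->] [b tb ->]; rewrite (den1_fun ta tb).
- move=> [a [b [e [ta ub ->]]]] [a' [b' [e' [ta' ub' ->]]]].
  by apply: vcomp_eq; [exact: IHt|exact: IHu].
- move=> [a [b [e [ta ub ->]]]] [a' [b' [e' [ta' ub' ->]]]].
  by apply: hcomp_eq; [exact: IHt|exact: IHu].
Qed.

Lemma ev0_inj (q r : quot den0) : (forall D, ev q D = ev r D) -> q = r.
Proof. exact: (ev_inj den0_fun). Qed.

Lemma ev1_inj (q r : quot den1) : (forall D, ev q D = ev r D) -> q = r.
Proof. exact: (ev_inj den1_fun). Qed.

Lemma ev2_inj (q r : quot den2) : (forall D, ev q D = ev r D) -> q = r.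
Proof. exact: (ev_inj den2_fun). Qed.

Ltac ev_ext := first [apply: ev0_inj | apply: ev1_inj | apply: ev2_inj].

Notation fam0 := (forall D : model, ob D).
Notation fam1 := (forall D : model, ar D).
Notation fam2 := (forall D : model, ce D).


Lemma den1_glue t (P : forall D : model, ar D -> Prop) :
  (forall D, exists2 a, @den1 D t a & P D a) ->
  exists2 f : fam1, forall D, den1 t (f D) & forall D, P D (f D).
Proof. by move=> H; exists (fun D => s2val (cid2 (H D))) => D; case: cid2. Qed.

Lemma den2_glue t (P : forall D : model, ce D -> Prop) :
  (forall D, exists2 a, @den2 D t a & P D a) ->
  exists2 f : fam2, forall D, den2 t (f D) & forall D, P D (f D).
Proof. by move=> H; exists (fun D => s2val (cid2 (H D))) => D; case: cid2. Qed.

Lemma glued_src (f : fam1) : glued den1 f -> glued den0 (fun D => src (f D)).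
Proof.
case=> t; elim: t f => [m x S|t|t IHt u _] f Hf.
- by exists (Gen0 x (src S)) => D; rewrite /den0 (Hf D) far_src.
- by exists t => D; rewrite /den0 (Hf D) src_id1.
have [|g /IHt[s Hs] gf] := @den1_glue t (fun D a => src a = src (f D)).
  by move=> D; have [a [b [e [ta _ ->]]]] := Hf D; exists a; rewrite ?src_comp.
by exists s => D; rewrite -gf.
Qed.

Lemma glued_tgt (f : fam1) : glued den1 f -> glued den0 (fun D => tgt (f D)).
Proof.
case=> t; elim: t f => [m x S|t|t _ u IHu] f Hf.
- by exists (Gen0 x (tgt S)) => D; rewrite /den0 (Hf D) far_tgt.
- by exists t => D; rewrite /den0 (Hf D) tgt_id1.
have [|g /IHu[s Hs] gf] := @den1_glue u (fun D a => tgt a = tgt (f D)).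
  by move=> D; have [a [b [e [_ ub ->]]]] := Hf D; exists b; rewrite ?tgt_comp.
by exists s => D; rewrite -gf.
Qed.

Lemma glued_id1 (x : fam0) : glued den0 x -> glued den1 (fun D => id1 (x D)).
Proof. by case=> t Ht; exists (Id1 t) => D /=; rewrite -(Ht D). Qed.

Lemma glued_comp (f g : fam1) (e : forall D, tgt (f D) = src (g D)) :
  glued den1 f -> glued den1 g -> glued den1 (fun D => comp (e D)).
Proof.
by case=> t Ht [u Hu]; exists (Comp t u) => D; exists (f D), (g D), (e D).
Qed.

Lemma glued_id2 (f : fam1) : glued den1 f -> glued den2 (fun D => id2 (f D)).
Proof. by case=> t Ht; exists (Id2 t) => D /=; exists (f D). Qed.

Lemma glued_vcomp (a b : fam2) (e : forall D, cod (a D) = dom (b D)) :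
  glued den2 a -> glued den2 b -> glued den2 (fun D => vcomp (e D)).
Proof.
by case=> t Ht [u Hu]; exists (VComp t u) => D; exists (a D), (b D), (e D).
Qed.

Lemma glued_hcomp (a b : fam2) (e : forall D, tgt (dom (a D)) = src (dom (b D))) :
  glued den2 a -> glued den2 b -> glued den2 (fun D => hcomp (e D)).
Proof.
by case=> t Ht [u Hu]; exists (HComp t u) => D; exists (a D), (b D), (e D).
Qed.

Lemma glued_dom (a : fam2) : glued den2 a -> glued den1 (fun D => dom (a D)).
Proof.
case=> t; elim: t a => [m x S|t|t IHt u _|t IHt u IHu] f Hf.
- by exists (Gen1 x (dom S)) => D /=; rewrite (Hf D) fce_dom.
- by exists t => D; have [a ta ->] := Hf D; rewrite dom_id2.
- have [|g /IHt[s Hs] gf] := @den2_glue t (fun D a => dom a = dom (f D)).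
    by move=> D; have [a [b [e [ta _ ->]]]] := Hf D; exists a; rewrite ?dom_vcomp.
  by exists s => D; rewrite -gf.
have [|g tg gf] := @den2_glue t (fun D a =>
    exists2 b, den2 u b & exists e, f D = @hcomp D a b e).
  move=> D; have [a [b [e [ta ub ->]]]] := Hf D; exists a => //; exists b => //.
  by exists e.
have [h uh hf] := den2_glue gf.
have [s Hs] := IHt g tg; have [s' Hs'] := IHu h uh.
exists (Comp s s') => D; have [e fE] := hf D.
by exists (dom (g D)), (dom (h D)), e; split=> //; rewrite fE dom_hcomp.
Qed.

Lemma glued_cod (a : fam2) : glued den2 a -> glued den1 (fun D => cod (a D)).
Proof.
case=> t; elim: t a => [m x S|t|t _ u IHu|t IHt u IHu] f Hf.
- by exists (Gen1 x (cod S)) => D /=; rewrite (Hf D) fce_cod.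
- by exists t => D; have [a ta ->] := Hf D; rewrite cod_id2.
- have [|g /IHu[s Hs] gf] := @den2_glue u (fun D a => cod a = cod (f D)).
    by move=> D; have [a [b [e [_ ub ->]]]] := Hf D; exists b; rewrite ?cod_vcomp.
  by exists s => D; rewrite -gf.
have [|g tg gf] := @den2_glue t (fun D a =>
    exists2 b, den2 u b & exists e, f D = @hcomp D a b e).
  move=> D; have [a [b [e [ta ub ->]]]] := Hf D; exists a => //; exists b => //.
  by exists e.
have [h uh hf] := den2_glue gf.
have [s Hs] := IHt g tg; have [s' Hs'] := IHu h uh.
exists (Comp s s') => D; have [e fE] := hf D.
have e' : tgt (cod (g D)) = src (cod (h D)) by rewrite tgt_cod src_cod.
by exists (cod (g D)), (cod (h D)), e'; split=> //; rewrite fE cod_hcomp.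
Qed.

Definition fob_ := quot den0.
Definition far_ := quot den1.
Definition fce_ := quot den2.

Implicit Types (x : fob_) (f g : far_) (a b : fce_).

Definition fsrc f : fob_ := glue den0_fun (glued_src (ev_rep f)).
Definition ftgt f : fob_ := glue den0_fun (glued_tgt (ev_rep f)).
Definition fdom a : far_ := glue den1_fun (glued_dom (ev_rep a)).
Definition fcod a : far_ := glue den1_fun (glued_cod (ev_rep a)).

Lemma ev_fsrc f D : ev (fsrc f) D = src (ev f D). Proof. by rewrite ev_glue. Qed.
Lemma ev_ftgt f D : ev (ftgt f) D = tgt (ev f D). Proof. by rewrite ev_glue. Qed.
Lemma ev_fdom a D : ev (fdom a) D = dom (ev a D). Proof. by rewrite ev_glue. Qed.
Lemma ev_fcod a D : ev (fcod a) D = cod (ev a D). Proof. by rewrite ev_glue. Qed.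

Lemma ev_composable f g : ftgt f = fsrc g ->
  forall D, tgt (ev f D) = src (ev g D).
Proof. by move=> e D; rewrite -ev_ftgt e ev_fsrc. Qed.

Lemma ev_vcomposable a b : fcod a = fdom b ->
  forall D, cod (ev a D) = dom (ev b D).
Proof. by move=> e D; rewrite -ev_fcod e ev_fdom. Qed.

Lemma ev_hcomposable a b : ftgt (fdom a) = fsrc (fdom b) ->
  forall D, tgt (dom (ev a D)) = src (dom (ev b D)).
Proof. by move=> e D; rewrite -!ev_fdom -ev_ftgt e ev_fsrc. Qed.

Definition fid1 x : far_ := glue den1_fun (glued_id1 (ev_rep x)).
Definition fid2 f : fce_ := glue den2_fun (glued_id2 (ev_rep f)).
Definition fcomp f g (e : ftgt f = fsrc g) : far_ :=
  glue den1_fun (glued_comp (ev_composable e) (ev_rep f) (ev_rep g)).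
Definition fvcomp a b (e : fcod a = fdom b) : fce_ :=
  glue den2_fun (glued_vcomp (ev_vcomposable e) (ev_rep a) (ev_rep b)).
Definition fhcomp a b (e : ftgt (fdom a) = fsrc (fdom b)) : fce_ :=
  glue den2_fun (glued_hcomp (ev_hcomposable e) (ev_rep a) (ev_rep b)).

Lemma ev_fid1 x D : ev (fid1 x) D = id1 (ev x D). Proof. by rewrite ev_glue. Qed.
Lemma ev_fid2 f D : ev (fid2 f) D = id2 (ev f D). Proof. by rewrite ev_glue. Qed.
Lemma ev_fcomp f g e D e' : ev (@fcomp f g e) D = @comp D (ev f D) (ev g D) e'.
Proof. by rewrite [LHS]ev_glue; apply: comp_eq. Qed.
Lemma ev_fvcomp a b e D e' :
  ev (@fvcomp a b e) D = @vcomp D (ev a D) (ev b D) e'.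
Proof. by rewrite [LHS]ev_glue; apply: vcomp_eq. Qed.
Lemma ev_fhcomp a b e D e' :
  ev (@fhcomp a b e) D = @hcomp D (ev a D) (ev b D) e'.
Proof. by rewrite [LHS]ev_glue; apply: hcomp_eq. Qed.

Definition evE := (ev_fsrc, ev_ftgt, ev_fdom, ev_fcod, ev_fid1, ev_fid2).

Definition c2_ob : twocat.
Proof.
refine (@TwoCat fob_ far_ fce_ fsrc ftgt fdom fcod _ _
  fid1 fcomp _ _ _ _ _ _ _
  fid2 fvcomp _ _ _ _ _ _ _
  fhcomp _ _ _ _ _ _ _).
- by move=> a; ev_ext => D; rewrite !evE src_cod.
- by move=> a; ev_ext => D; rewrite !evE tgt_cod.
- by move=> x; ev_ext => D; rewrite !evE src_id1.
- by move=> x; ev_ext => D; rewrite !evE tgt_id1.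
- by move=> f g e; ev_ext => D; rewrite !ev_fsrc ev_glue src_comp.
- by move=> f g e; ev_ext => D; rewrite !ev_ftgt ev_glue tgt_comp.
- move=> f e; ev_ext => D; rewrite [LHS]ev_glue.
  move: (ev_composable e D); rewrite !evE => e'; exact: comp1f.
- move=> f e; ev_ext => D; rewrite [LHS]ev_glue.
  move: (ev_composable e D); rewrite !evE => e'; exact: compf1.
- move=> f g h e1 e2 e3 e4; ev_ext => D; rewrite [LHS]ev_glue [RHS]ev_glue.
  move: (ev_composable e2 D) (ev_composable e4 D); rewrite !ev_glue => e e'.
  exact: compA.
- by move=> f; ev_ext => D; rewrite !evE dom_id2.
- by move=> f; ev_ext => D; rewrite !evE cod_id2.
- by move=> f g e; ev_ext => D; rewrite !ev_fdom ev_glue dom_vcomp.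
- by move=> f g e; ev_ext => D; rewrite !ev_fcod ev_glue cod_vcomp.
- move=> f e; ev_ext => D; rewrite [LHS]ev_glue.
  move: (ev_vcomposable e D); rewrite !evE => e'; exact: vcomp1a.
- move=> f e; ev_ext => D; rewrite [LHS]ev_glue.
  move: (ev_vcomposable e D); rewrite !evE => e'; exact: vcompa1.
- move=> f g h e1 e2 e3 e4; ev_ext => D; rewrite [LHS]ev_glue [RHS]ev_glue.
  move: (ev_vcomposable e2 D) (ev_vcomposable e4 D); rewrite !ev_glue => e e'.
  exact: vcompA.
- move=> a b e e'; ev_ext => D; rewrite evE [ev (fhcomp _) _]ev_glue [RHS]ev_glue.
  by move: (ev_composable e' D); rewrite !evE => p; rewrite dom_hcomp.
- move=> a b e e'; ev_ext => D; rewrite evE [ev (fhcomp _) _]ev_glue [RHS]ev_glue.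
  by move: (ev_composable e' D); rewrite !evE => p; rewrite cod_hcomp.
- move=> f e; ev_ext => D; rewrite [LHS]ev_glue.
  move: (ev_hcomposable e D); rewrite !evE => e'; exact: hcomp1a.
- move=> f e; ev_ext => D; rewrite [LHS]ev_glue.
  move: (ev_hcomposable e D); rewrite !evE => e'; exact: hcompa1.
- move=> f g h e1 e2 e3 e4; ev_ext => D; rewrite [LHS]ev_glue [RHS]ev_glue.
  move: (ev_hcomposable e2 D) (ev_hcomposable e4 D); rewrite !ev_glue => e e'.
  exact: hcompA.
- move=> f g e e'; ev_ext => D; rewrite [LHS]ev_glue [RHS]ev_fid2.
  move: (ev_hcomposable e D); rewrite !ev_fid2 => p.
  by rewrite [ev (fcomp _) _]ev_glue (hcomp_id2 p (ev_composable e' D)).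
- move=> a a' b b' e1 e2 e3 e4 e5 e6; ev_ext => D.
  rewrite [LHS]ev_glue [RHS]ev_glue.
  move: (ev_hcomposable e3 D) (ev_vcomposable e6 D); rewrite !ev_glue => e e'.
  exact: interchange.
Defined.

Section Unit.
Variables (m : nat) (x : X m).

Lemma glued_gen0 k : glued den0 (fun D : model => fob (model_map D m x) k).
Proof. by exists (Gen0 x k). Qed.

Lemma glued_gen1 S : glued den1 (fun D : model => far (model_map D m x) S).
Proof. by exists (Gen1 x S). Qed.

Lemma glued_gen2 (a : ce (oriental m)) : glued den2 (fun D : model => fce (model_map D m x) a).
Proof. by exists (Gen2 x a). Qed.

Definition c2_unit_simplex : N2 c2_ob m.
Proof.
refine (@TwoFun (oriental m) c2_ob
  (fun k => glue den0_fun (glued_gen0 k))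
  (fun S => glue den1_fun (glued_gen1 S))
  (fun a : ce (oriental m) => glue den2_fun (glued_gen2 a)) _ _ _ _ _ _ _ _ _).
- by move=> f; ev_ext => D; rewrite ev_fsrc !ev_glue far_src.
- by move=> f; ev_ext => D; rewrite ev_ftgt !ev_glue far_tgt.
- by move=> f; ev_ext => D; rewrite ev_fdom !ev_glue fce_dom.
- by move=> f; ev_ext => D; rewrite ev_fcod !ev_glue fce_cod.
- by move=> f; ev_ext => D; rewrite ev_fid1 !ev_glue far_id1.
- move=> f g e e'; ev_ext => D; rewrite [LHS]ev_glue [RHS]ev_glue.
  by move: (ev_composable e' D); rewrite !ev_glue => p; rewrite (far_comp e p).
- by move=> f; ev_ext => D; rewrite ev_fid2 !ev_glue fce_id2.
- move=> f g e e'; ev_ext => D; rewrite [LHS]ev_glue [RHS]ev_glue.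
  by move: (ev_vcomposable e' D); rewrite !ev_glue => p; rewrite (fce_vcomp e p).
- move=> f g e e'; ev_ext => D; rewrite [LHS]ev_glue [RHS]ev_glue.
  by move: (ev_hcomposable e' D); rewrite !ev_glue => p; rewrite (fce_hcomp e p).
Defined.

End Unit.

Definition c2_unit : smap X (N2 c2_ob).
Proof.
refine (@SMap X (N2 c2_ob) c2_unit_simplex _).
by move=> m n f x; apply: twofun_ext => a; ev_ext => D;
  rewrite [LHS]ev_glue [RHS]ev_glue smap_nat.
Defined.

Definition c2_lift (D : twocat) (f : smap X (N2 D)) : twofun c2_ob D.
Proof.
pose M := Model f.
refine (@TwoFun c2_ob D (fun q => ev q M) (fun q => ev q M) (fun q => ev q M)
  _ _ _ _ _ _ _ _ _).
- by move=> q; rewrite ev_fsrc.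
- by move=> q; rewrite ev_ftgt.
- by move=> q; rewrite ev_fdom.
- by move=> q; rewrite ev_fcod.
- by move=> q; rewrite ev_fid1.
- by move=> q r e e'; apply: (@ev_fcomp q r e M e').
- by move=> q; rewrite ev_fid2.
- by move=> q r e e'; apply: (@ev_fvcomp q r e M e').
- by move=> q r e e'; apply: (@ev_fhcomp q r e M e').
Defined.

Lemma c2_liftE D (f : smap X (N2 D)) : smap_comp (N2_map (c2_lift f)) c2_unit = f.
Proof.
by apply: smap_ext => n x; apply: twofun_ext => a; rewrite /= ev_glue.
Qed.

Lemma c2_lift_unique D (F G : twofun c2_ob D) :
  smap_comp (N2_map F) c2_unit = smap_comp (N2_map G) c2_unit -> F = G.
Proof.
move=> FG.
have FGx n (x : X n) : twofun_comp F (c2_unit n x) = twofun_comp G (c2_unit n x).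
  exact: (congr1 (fun f : smap X (N2 D) => f n x) FG).
have FG0 (q : fob_) : fob F q = fob G q.
  have [[m x k] qE] := ev_rep q.
  have -> : q = fob (c2_unit m x) k.
    by ev_ext => M; rewrite [RHS]ev_glue qE.
  exact: (congr1 (fun H => fob H k) (FGx m x)).
have FG1 (q : far_) : far F q = far G q.
  have [t] := ev_rep q; elim: t q => [m x S|t|t IHt u IHu] q qE.
  - have -> : q = far (c2_unit m x) S.
      by ev_ext => M; rewrite [RHS]ev_glue qE.
    exact: (congr1 (fun H => far H S) (FGx m x)).
  - have H : glued den0 (fun M => val0 M t) by exists t.
    have -> : q = id1 (glue den0_fun H : ob c2_ob).
      by ev_ext => M; rewrite ev_fid1 ev_glue qE.
    by rewrite !far_id1 FG0.
  have [|f tf] := @den1_glue t (fun M (a : ar M) =>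
      exists2 b : ar M, den1 u b & exists e, ev q M = @comp M a b e).
    move=> M; have [a [b [e [ta ub ->]]]] := qE M.
    by exists a => //; exists b => //; exists e.
  case/den1_glue=> g ug fg.
  have Hf : glued den1 f by exists t.
  have Hg : glued den1 g by exists u.
  pose f' := glue den1_fun Hf : ar c2_ob; pose g' := glue den1_fun Hg : ar c2_ob.
  have e : tgt f' = src g'.
    by ev_ext => M; rewrite ev_ftgt ev_fsrc !ev_glue; case: (fg M).
  have -> : q = comp e.
    ev_ext => M; have [p ->] := fg M; rewrite [RHS]ev_glue.
    by apply: comp_eq; rewrite ev_glue.
  have Ff : far F f' = far G f' by apply: IHt => M; rewrite ev_glue.
  have Fg : far F g' = far G g' by apply: IHu => M; rewrite ev_glue.
  have eF : tgt (far F f') = src (far F g') by rewrite far_tgt far_src e.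
  have eG : tgt (far G f') = src (far G g') by rewrite far_tgt far_src e.
  by rewrite (far_comp e eF) (far_comp e eG); apply: comp_eq.
have FG2 (q : fce_) : fce F q = fce G q.
  have [t] := ev_rep q; elim: t q => [m x a|t|t IHt u IHu|t IHt u IHu] q qE.
  - have -> : q = fce (c2_unit m x) a.
      by ev_ext => M; rewrite [RHS]ev_glue qE.
    exact: (congr1 (fun H => fce H a) (FGx m x)).
  - have [f tf fq] := den1_glue (P := fun M (a : ar M) => ev q M = id2 a) qE.
    have Hf : glued den1 f by exists t.
    have -> : q = id2 (glue den1_fun Hf : ar c2_ob).
      by ev_ext => M; rewrite ev_fid2 ev_glue fq.
    by rewrite !fce_id2 FG1.
  - have [|f tf] := @den2_glue t (fun M (a : ce M) =>
      exists2 b : ce M, den2 u b & exists e, ev q M = @vcomp M a b e).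
      move=> M; have [a [b [e [ta ub ->]]]] := qE M.
      by exists a => //; exists b => //; exists e.
    case/den2_glue=> g ug fg.
    have Hf : glued den2 f by exists t.
    have Hg : glued den2 g by exists u.
    pose f' := glue den2_fun Hf : ce c2_ob; pose g' := glue den2_fun Hg : ce c2_ob.
    have e : cod f' = dom g'.
      by ev_ext => M; rewrite ev_fcod ev_fdom !ev_glue; case: (fg M).
    have -> : q = vcomp e.
      ev_ext => M; have [p ->] := fg M; rewrite [RHS]ev_glue.
      by apply: vcomp_eq; rewrite ev_glue.
    have Ff : fce F f' = fce G f' by apply: IHt => M; rewrite ev_glue.
    have Fg : fce F g' = fce G g' by apply: IHu => M; rewrite ev_glue.
    have eF : cod (fce F f') = dom (fce F g') by rewrite fce_cod fce_dom e.
    have eG : cod (fce G f') = dom (fce G g') by rewrite fce_cod fce_dom e.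
    by rewrite (fce_vcomp e eF) (fce_vcomp e eG); apply: vcomp_eq.
  have [|f tf] := @den2_glue t (fun M (a : ce M) =>
      exists2 b : ce M, den2 u b & exists e, ev q M = @hcomp M a b e).
    move=> M; have [a [b [e [ta ub ->]]]] := qE M.
    by exists a => //; exists b => //; exists e.
  case/den2_glue=> g ug fg.
  have Hf : glued den2 f by exists t.
  have Hg : glued den2 g by exists u.
  pose f' := glue den2_fun Hf : ce c2_ob; pose g' := glue den2_fun Hg : ce c2_ob.
  have e : tgt (dom f') = src (dom g').
    ev_ext => M; rewrite ev_ftgt ev_fsrc !ev_fdom !ev_glue.
    by case: (fg M).
  have -> : q = hcomp e.
    ev_ext => M; have [p ->] := fg M; rewrite [RHS]ev_glue.
    by apply: hcomp_eq; rewrite ev_glue.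
  have Ff : fce F f' = fce G f' by apply: IHt => M; rewrite ev_glue.
  have Fg : fce F g' = fce G g' by apply: IHu => M; rewrite ev_glue.
  have eF : tgt (dom (fce F f')) = src (dom (fce F g')).
    by rewrite !fce_dom far_tgt far_src e.
  have eG : tgt (dom (fce G f')) = src (dom (fce G g')).
    by rewrite !fce_dom far_tgt far_src e.
  by rewrite (fce_hcomp e eF) (fce_hcomp e eG); apply: hcomp_eq.
exact: twofun_ext.
Qed.

End FreeTwocat.

Definition c2_map X Y (f : smap X Y) : twofun (c2_ob X) (c2_ob Y) :=
  c2_lift (smap_comp (c2_unit Y) f).

Lemma N2_map_comp C D E (G : twofun D E) (F : twofun C D) :
  N2_map (twofun_comp G F) = smap_comp (N2_map G) (N2_map F).
Proof. by apply: smap_ext => n x; apply: twofun_ext. Qed.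

Lemma smap_compA X Y Z T (h : smap Z T) (g : smap Y Z) (f : smap X Y) :
  smap_comp h (smap_comp g f) = smap_comp (smap_comp h g) f.
Proof. exact: smap_ext. Qed.

Theorem left_adjoint_N2_exists : inhabited left_adjoint_N2.
Proof.
constructor; refine (@LeftAdjointN2 c2_ob c2_map _ _ c2_unit _ _).
- move=> X; apply: c2_lift_unique; rewrite c2_liftE.
  by apply: smap_ext => n x; apply: twofun_ext.
- move=> X Y Z g f; apply: c2_lift_unique; rewrite c2_liftE.
  by rewrite N2_map_comp -smap_compA c2_liftE !smap_compA c2_liftE.
- by move=> X Y f; apply: c2_liftE.
- move=> X D f; exists (c2_lift f); split; first exact: c2_liftE.
  by move=> G GE; apply: c2_lift_unique; rewrite c2_liftE.
Qed.

(* Main.v *)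
Require Import Defs.
From mathcomp Require Import all_boot all_order.
From mathcomp Require Import boolp.
From Stdlib Require Import Relation_Operators.

Set Implicit Arguments.
Unset Strict Implicit.
Unset Printing Implicit Defensive.

Import Order.Theory.
Local Open Scope order_scope.

(* c_2 N(E) is the 2-category of finite chains of E: an arrow from v to w is a
   finite chain with minimum v and maximum w, the 2-arrows are the inclusions.
   An m-simplex of N_2 of this 2-category is a family of vertices x_0 <= ... <= x_m
   with chains f_ij from x_i to x_j such that f_ik is included in the union of f_ij
   and f_jk.  Since {x_i, x_j} is the smallest chain from x_i to x_j, forgetting the
   f_ij retracts N_2 c_2 N(E) onto N(E), and along a : Delta_m -> Delta_1 the
   homotopy from this retraction to the identity replaces f_ij by {x_i, x_j} when
   a(i) = 0 and keeps it when a(i) = 1.  Of the universal property of the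
   2-category of chains, only the existence half is needed: it makes c_2 N(E) a
   retract of this 2-category, compatibly with the maps from N(E). *)

(** * Homotopies and deformation retracts of simplicial sets *)

Section Homotopy.
Variables X Y Z : sset.

Lemma elementary_homotopy_compl (g : smap Y Z) (f f' : smap X Y) :
  elementary_homotopy f f' ->
  elementary_homotopy (smap_comp g f) (smap_comp g f').
Proof.
case=> h H; exists (smap_comp g h) => n x /=.
by have [-> ->] := H n x.
Qed.

Lemma elementary_homotopy_compr (g g' : smap Y Z) (f : smap X Y) :
  elementary_homotopy g g' ->
  elementary_homotopy (smap_comp g f) (smap_comp g' f).
Proof.
case=> h H.
have nat m n (u : {omorphism ord m -> ord n}) (z : sprod X (stdsimplex 1) n) :
    h m (f m (act u z).1, (act u z).2) = act u (h n (f n z.1, z.2)).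
  by rewrite -smap_nat /= smap_nat.
by exists (@SMap (sprod X (stdsimplex 1)) Z (fun n z => h n (f n z.1, z.2)) nat)
  => n x; apply: H.
Qed.

Lemma homotopic_compl (g : smap Y Z) (f f' : smap X Y) :
  homotopic f f' -> homotopic (smap_comp g f) (smap_comp g f').
Proof.
elim=> [a b /(elementary_homotopy_compl g) ab|a|a b _|a b c _ ab _ bc].
- exact: rst_step.
- exact: rst_refl.
- exact: rst_sym.
- exact: rst_trans ab bc.
Qed.

Lemma homotopic_compr (g g' : smap Y Z) (f : smap X Y) :
  homotopic g g' -> homotopic (smap_comp g f) (smap_comp g' f).
Proof.
elim=> [a b /(elementary_homotopy_compr f) ab|a|a b _|a b c _ ab _ bc].
- exact: rst_step.
- exact: rst_refl.
- exact: rst_sym.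
- exact: rst_trans ab bc.
Qed.

End Homotopy.

(** Precomposition with [r] inverts precomposition with [f] on homotopy classes: a map [k] is
    homotopic to its restriction along [f] extended back along [r], and [g] extended along [r]
    restricts strictly to [g]. *)
Lemma deformation_retract_weak_equivalence X Y (f : smap X Y) (r : smap Y X) :
  smap_comp r f = smap_id X -> homotopic (smap_comp f r) (smap_id Y) ->
  weak_equivalence f.
Proof.
move=> rf fr K _; split=> [g h gh|g].
- have key (k : smap Y K) : homotopic (smap_comp (smap_comp k f) r) k.
    have kE : smap_comp k (smap_id Y) = k by apply: smap_ext.
    by rewrite -[X in homotopic _ X]kE -smap_compA; apply: homotopic_compl.
  apply: rst_trans (key h); apply: rst_trans (homotopic_compr r gh).
  exact/rst_sym/key.
- exists (smap_comp g r); rewrite -smap_compA rf.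
  have -> : smap_comp g (smap_id X) = g by apply: smap_ext.
  exact: rst_refl.
Qed.

Section OrderMorphism.
Context d (T : porderType d) d' (T' : porderType d').

Lemma omorphism_of (f : T -> T') :
  {homo f : x y / x <= y} -> exists g : {omorphism T -> T'}, g =1 f.
Proof.
move=> Hf; unshelve eexists (@Order.OrderMorphism.Pack _ _ _ _ f _) => //.
Qed.

End OrderMorphism.

(** * The 2-category of finite chains of a partially ordered set *)

Section Chains.
Variables (d : Order.disp_t) (E : porderType d).

(** The fields characterize the sets of vertices of simplices of the nerve (see [chain_im] and
    [chain_realize]). Endpoints are recorded so that source and target are projections; [chain_ext]
    recovers them from the set by antisymmetry. *)
Record chain := Chain {
  csrc : E;
  ctgt : E;
  cset : E -> Prop;
  csrc_in : cset csrc;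
  ctgt_in : cset ctgt;
  csrc_min : forall v, cset v -> csrc <= v;
  ctgt_max : forall v, cset v -> v <= ctgt;
  cset_finite : exists s : seq E, forall v, cset v -> v \in s;
  cset_total : forall v w, cset v -> cset w -> v >=< w }.

Lemma chain_ext (S T : chain) : (forall v, cset S v <-> cset T v) -> S = T.
Proof.
move=> ST; have {ST} eST : cset S = cset T.
  by apply: funext => v; apply: propext.
case: S T eST => k l S kS lS Sk Sl Sf St [k' l' S' kS' lS' Sk' Sl' Sf' St'] /= eS.
subst S'.
have ek : k = k' by apply/le_anti; rewrite Sk // Sk'.
have el : l = l' by apply/le_anti; rewrite Sl' // Sl.
by subst k' l'; congr Chain; apply: Prop_irrelevance.
Qed.

Lemma csrc_le_ctgt (S : chain) : csrc S <= ctgt S.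
Proof. exact/csrc_min/ctgt_in. Qed.

Record chain_incl := ChainIncl {
  cdom : chain;
  ccod : chain;
  cincl_src : csrc ccod = csrc cdom;
  cincl_tgt : ctgt ccod = ctgt cdom;
  cincl_sub : forall v, cset cdom v -> cset ccod v }.

Lemma chain_incl_ext (a b : chain_incl) :
  cdom a = cdom b -> ccod a = ccod b -> a = b.
Proof.
case: a b => S T ? ? ? [S' T' ? ? ?] /= eS eT; subst S' T'.
by congr ChainIncl; apply: Prop_irrelevance.
Qed.

Definition chain_id (v : E) : chain.
Proof.
apply: (@Chain v v (fun w => w = v)) => //.
- by move=> w ->.
- by move=> w ->.
- by exists [:: v] => w ->; rewrite mem_head.
- by move=> w w' -> ->; apply: comparablexx.
Defined.

Lemma cset_le (S T : chain) (e : ctgt S = csrc T) v w :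
  cset S v -> cset T w -> v <= w.
Proof. by move=> /ctgt_max vS /csrc_min; apply: le_trans; rewrite -e. Qed.

Definition chain_comp (S T : chain) (e : ctgt S = csrc T) : chain.
Proof.
apply: (@Chain (csrc S) (ctgt T) (fun v => cset S v \/ cset T v)).
- by left; apply: csrc_in.
- by right; apply: ctgt_in.
- by move=> v [/csrc_min //|]; apply/(cset_le e)/csrc_in.
- by move=> v [vS|/ctgt_max //]; apply/(cset_le e)/ctgt_in.
- have [[s Ss] [t Tt]] := (cset_finite S, cset_finite T).
  by exists (s ++ t) => v; rewrite mem_cat => -[/Ss ->|/Tt ->]; rewrite ?orbT.
- move=> v w [vS|vT] [wS|wT]; [exact: cset_total vS wS| | |exact: cset_total vT wT].
    exact/le_comparable/(cset_le e).
  exact/ge_comparable/(cset_le e).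
Defined.

Definition chain_id2 (S : chain) : chain_incl :=
  @ChainIncl S S erefl erefl (fun v Sv => Sv).

Definition chain_vcomp (a b : chain_incl) (e : ccod a = cdom b) : chain_incl.
Proof.
apply: (@ChainIncl (cdom a) (ccod b)).
- by rewrite cincl_src -e cincl_src.
- by rewrite cincl_tgt -e cincl_tgt.
- by move=> v /cincl_sub; rewrite e; apply: cincl_sub.
Defined.

Lemma chain_hcomp_subproof (a b : chain_incl) :
  ctgt (cdom a) = csrc (cdom b) -> ctgt (ccod a) = csrc (ccod b).
Proof. by rewrite cincl_src cincl_tgt. Qed.

Definition chain_hcomp (a b : chain_incl) (e : ctgt (cdom a) = csrc (cdom b)) :
  chain_incl.
Proof.
apply: (@ChainIncl (chain_comp e) (chain_comp (chain_hcomp_subproof e))) => /=.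
- exact: cincl_src.
- exact: cincl_tgt.
- by move=> v [/cincl_sub|/cincl_sub]; [left|right].
Defined.

Lemma chain_comp1f S e : @chain_comp (chain_id (csrc S)) S e = S.
Proof.
by apply: chain_ext => v /=; split=> [[->|]|]; auto; apply: csrc_in.
Qed.

Lemma chain_compf1 S e : @chain_comp S (chain_id (ctgt S)) e = S.
Proof.
by apply: chain_ext => v /=; split=> [[|->]|]; auto; apply: ctgt_in.
Qed.

Lemma chain_compA S T U e1 e2 e3 e4 :
  @chain_comp S (@chain_comp T U e1) e2 = @chain_comp (@chain_comp S T e3) U e4.
Proof. by apply: chain_ext => v /=; tauto. Qed.

Lemma chain_comp_eq S S' T T' e e' :
  S = S' -> T = T' -> @chain_comp S T e = @chain_comp S' T' e'.
Proof. by move=> eS eT; subst S' T'; rewrite (Prop_irrelevance e e'). Qed.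

Definition chains : twocat.
Proof.
refine (@TwoCat E chain chain_incl csrc ctgt cdom ccod cincl_src cincl_tgt
  chain_id chain_comp _ _ _ _ chain_comp1f chain_compf1 chain_compA
  chain_id2 chain_vcomp _ _ _ _ _ _ _
  chain_hcomp _ _ _ _ _ _ _) => //.
- by move=> *; apply: chain_incl_ext.
- by move=> *; apply: chain_incl_ext.
- by move=> *; apply: chain_incl_ext.
- by move=> *; apply: chain_comp_eq.
- by move=> *; apply: chain_comp_eq.
- move=> a e; apply: chain_incl_ext => /=; first exact: chain_comp1f.
  (* With the composability proof generalized, the unit at the source of the domain can be rewritten
     as the unit at the source of the codomain. *)
  by move: (chain_hcomp_subproof e) => /=; rewrite -cincl_src; apply: chain_comp1f.
- move=> a e; apply: chain_incl_ext => /=; first exact: chain_compf1.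
  by move: (chain_hcomp_subproof e) => /=; rewrite -cincl_tgt; apply: chain_compf1.
- by move=> *; apply: chain_incl_ext; apply: chain_compA.
- by move=> *; apply: chain_incl_ext; apply: chain_comp_eq.
- by move=> *; apply: chain_incl_ext; apply: chain_comp_eq.
Defined.

(** * The map from the nerve to N_2 of the 2-category of chains *)

Section Image.
Variables (m : nat) (x : {omorphism ord m -> E}).

Definition chain_im (S : oarrow m) : chain.
Proof.
apply: (@Chain (x (osrc S)) (x (otgt S))
  (fun v => exists2 i, i \in oset S & v = x i)).
- by exists (osrc S) => //; apply: osrc_in.
- by exists (otgt S) => //; apply: otgt_in.
- by move=> _ [i iS ->]; apply/omorph_le/osrc_min.
- by move=> _ [i iS ->]; apply/omorph_le/otgt_max.
- by exists (codom x) => _ [i _ ->]; apply: codom_f.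
- move=> _ _ [i _ ->] [j _ ->]; rewrite /Order.comparable.
  by case/orP: (le_total i j) => /(omorph_le x) ->; rewrite ?orbT.
Defined.

Definition chain_incl_im (a : ocell m) : chain_incl.
Proof.
apply: (@ChainIncl (chain_im (odom a)) (chain_im (ocod a))) => /=.
- by rewrite ocell_src.
- by rewrite ocell_tgt.
- by move=> _ [i ia ->]; exists i => //; apply: (subsetP (ocell_sub a)).
Defined.

Lemma chain_im_comp S T e e' :
  chain_im (@ocomp m S T e) = @chain_comp (chain_im S) (chain_im T) e'.
Proof.
apply: chain_ext => v /=; split=> [[i]|].
  by rewrite inE => /orP[iS|iT] ->; [left|right]; exists i.
by case=> -[i iS ->]; exists i; rewrite // inE iS ?orbT.
Qed.

Definition chains_unit_simplex : N2 chains m.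
Proof.
refine (@TwoFun (oriental m) chains x chain_im chain_incl_im
  _ _ _ _ _ _ _ _ _) => //.
- move=> k; apply: chain_ext => v /=; split=> [[i]|->].
    by rewrite inE => /eqP ->.
  by exists k; rewrite ?inE.
- exact: chain_im_comp.
- by move=> *; apply: chain_incl_ext.
- by move=> *; apply: chain_incl_ext.
- by move=> *; apply: chain_incl_ext; apply: chain_im_comp.
Defined.

End Image.

Lemma chain_im_map m n (x : {omorphism ord n -> E})
    (f : {omorphism ord m -> ord n}) S :
  chain_im (omcomp x f) S = chain_im x (oarrow_map f S).
Proof.
apply: chain_ext => v /=; split=> [[i iS ->]|[_ /imsetP[i iS ->] ->]].
  by exists (f i); rewrite ?imset_f.
by exists i.
Qed.

Definition chains_unit : smap (nerve E) (N2 chains).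
Proof.
refine (@SMap (nerve E) (N2 chains) chains_unit_simplex _).
move=> m n f x; apply: twofun_ext => //= S; first exact: chain_im_map.
by apply: chain_incl_ext; apply: chain_im_map.
Defined.

(** * Lifting chains and their composable inclusions to orientals *)

Lemma chain_realize (T : chain) :
  exists m (x : {omorphism ord m -> E}), forall v, cset T v <-> exists i, x i = v.
Proof.
have [s Ts] := cset_finite T.
(* Repetitions in [t] are harmless, since a simplex may be degenerate. The order is total only on
   the members of [T], hence the relative sorting lemma below. *)
pose t := sort <=%O [seq v <- s | `[< cset T v >]].
have tT v : v \in t <-> cset T v.
  rewrite mem_sort mem_filter; split=> [/andP[/asboolP //]|Tv].
  by rewrite Ts // andbT; apply/asboolP.
have t_sorted : sorted <=%O t.
  apply: (@sort_sorted_in _ [pred v | `[< cset T v >]]); last exact: filter_all.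
  by move=> v w /asboolP vT /asboolP wT; apply: cset_total vT wT.
have t_gt0 : (0 < size t)%N.
  have /tT := csrc_in T; by case: t {tT t_sorted}.
(* [ord] of the predecessor of [size t] has exactly [size t] elements, as [t] is nonempty; the
   default [csrc T] of [nth] is therefore never reached. *)
have [|x xE] := @omorphism_of _ (ord (size t).-1) _ E (fun i => nth (csrc T) t i).
  move=> i j ij; apply: (sorted_leq_nth le_trans lexx) => //;
    by rewrite inE -[X in (_ < X)%N](prednK t_gt0) ltn_ord.
exists (size t).-1, x => v; split=> [/tT vt|[i <-]].
  have vi : (index v t < (size t).-1.+1)%N by rewrite prednK // index_mem.
  by exists (Ordinal vi); rewrite xE nth_index.
by apply/tT; rewrite xE mem_nth // -[X in (_ < X)%N](prednK t_gt0) ltn_ord.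
Qed.

(* The lift sends [j] to the first index at which [x] takes the value [x' j]. *)
Lemma omorphism_lift m n (x : {omorphism ord m -> E}) (x' : {omorphism ord n -> E}) :
  (forall j, exists i, x i = x' j) ->
  exists2 t : {omorphism ord n -> ord m},
    omcomp x t = x' & forall j j', x' j = x' j' -> t j = t j'.
Proof.
move=> sub.
have first j : exists i, x i = x' j /\ forall k, x k = x' j -> i <= k.
  have [i0 /eqP xi0] := sub j.
  have [i /eqP xi imin] := @arg_minnP _ i0 (fun i => x i == x' j) val xi0.
  by exists i; split=> // k /eqP; apply: imin.
have [f fP] := choice first.
have f_homo : {homo f : j j' / j <= j'}.
  move=> j j' jj'; have [[xj jmin] [xj' _]] := (fP j, fP j').
  (* If [f j' <= f j], then x'(j') = x(f j') <= x(f j) = x'(j) <= x'(j'), so [x] takes the value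
     x'(j) at [f j'] too, and minimality of [f j] concludes. *)
  case/orP: (le_total (f j) (f j')) => [//|f_le]; apply: jmin; apply/le_anti.
  by rewrite -{1}xj (omorph_le x f_le) xj' (omorph_le x' jj').
have [t tE] := omorphism_of f_homo; exists t => [|j j' jj'].
  by apply: omorphism_ext => j /=; rewrite tE; case: (fP j).
have [[xj jmin] [xj' jmin']] := (fP j, fP j').
apply/le_anti; rewrite !tE; apply/andP.
by split; [apply: jmin; rewrite xj'|apply: jmin'; rewrite xj].
Qed.

(** As [x] may repeat values, the preimage of [T] can overflow the interval from [i] to [j]; cutting
    it there fixes the ends of the lift. Keeping all the indices inside makes the lift monotone in
    [T], so inclusions lift to 2-arrows. *)
Definition chain_restr_set m (x : {omorphism ord m -> E}) (i j : ord m) (T : chain) :=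
  [set l | (i <= l <= j) && `[< cset T (x l) >]].

Lemma chain_restr m (x : {omorphism ord m -> E}) i j (T : chain) :
  i <= j -> x i = csrc T -> x j = ctgt T ->
  (forall v, cset T v -> exists l, x l = v) ->
  exists S : oarrow m,
    [/\ osrc S = i, otgt S = j, oset S = chain_restr_set x i j T & chain_im x S = T].
Proof.
move=> ij xi xj Tx.
unshelve eexists (@OArrow m i j (chain_restr_set x i j T) _ _ _ _).
- by rewrite inE lexx ij; apply/asboolP; rewrite xi; apply: csrc_in.
- by rewrite inE lexx ij; apply/asboolP; rewrite xj; apply: ctgt_in.
- by move=> l; rewrite inE => /andP[/andP[]].
- by move=> l; rewrite inE => /andP[/andP[]].
split=> //; apply: chain_ext => v /=; split=> [[l]|vT].
  by rewrite inE => /andP[_ /asboolP ?] ->.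
have [l xl] := Tx v vT.
have in_ij k : i <= k <= j -> x k = v ->
    exists2 l, l \in chain_restr_set x i j T & v = x l.
  by move=> ikj xk; exists k; rewrite // inE ikj; apply/asboolP; rewrite xk.
(* An index outside the interval with value in [T] is replaced by the nearest end, which has the
   same value: for [l] below [i], x(l) <= x(i) = [csrc T] <= x(l). *)
have [il|/ltW li] := leP i l; last first.
  apply: (in_ij i); rewrite ?lexx ?ij //; apply/le_anti.
  by rewrite {1}xi csrc_min // -xl omorph_le.
have [lj|/ltW jl] := leP l j; first by apply: (in_ij l); rewrite ?il.
apply: (in_ij j); rewrite ?lexx ?ij //; apply/le_anti.
by rewrite {2}xj ctgt_max // -xl omorph_le.
Qed.

Lemma chain_restr_sub m (x : {omorphism ord m -> E}) i j (T T' : chain) :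
  (forall v, cset T v -> cset T' v) ->
  chain_restr_set x i j T \subset chain_restr_set x i j T'.
Proof.
move=> TT'; apply/subsetP=> l; rewrite !inE => /andP[-> /asboolP Tl].
by apply/asboolP/TT'.
Qed.

(** Control of the end indices is what makes two lifted inclusions horizontally composable in
    [chain_hcomp_realize]. *)
Lemma chain_incl_restr m (x : {omorphism ord m -> E}) i j (a : chain_incl) :
  i <= j -> x i = csrc (cdom a) -> x j = ctgt (cdom a) ->
  (forall v, cset (ccod a) v -> exists l, x l = v) ->
  exists c : ocell m,
    [/\ osrc (odom c) = i, otgt (odom c) = j & chain_incl_im x c = a].
Proof.
move=> ij xi xj ax.
have [|S [Si Sj SE xS]] := chain_restr ij xi xj.
  by move=> v /cincl_sub; apply: ax.
have [||T [Ti Tj TE xT]] := chain_restr ij _ _ ax; rewrite ?cincl_src ?cincl_tgt //.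
unshelve eexists (@OCell _ S T _ _ _); rewrite ?Si ?Sj //.
  by rewrite SE TE; apply/chain_restr_sub/cincl_sub.
by split=> //; apply: chain_incl_ext.
Qed.

(** The map [r] sends all indices with the same value to a common one, and the second map sends each
    index of [x'] to the one [r] assigns to its value. Subsets with the same image chain thus become
    equal, although [x] and [x'] may be degenerate. *)
Lemma chain_im_lift m n (x : {omorphism ord m -> E}) (x' : {omorphism ord n -> E}) :
  (forall j, exists i, x i = x' j) ->
  exists (r : {omorphism ord m -> ord m}) (t : {omorphism ord n -> ord m}),
    [/\ omcomp x r = x, omcomp x t = x' &
      forall S S', chain_im x S = chain_im x' S' -> oarrow_map r S = oarrow_map t S'].
Proof.
move=> sub; have [t xt _] := omorphism_lift sub.
have [r xr rE] : exists2 r : {omorphism ord m -> ord m},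
    omcomp x r = x & forall i j, x i = x j -> r i = r j.
  by apply: omorphism_lift => j; exists j.
have rtE i j : x i = x' j -> r i = omcomp r t j.
  by move=> xi; apply: rE; rewrite xi -xt.
have xrt : omcomp x (omcomp r t) = x'.
  by rewrite -xt -{2}xr; apply: omorphism_ext.
exists r, (omcomp r t); split=> // S S' SS'; apply: oarrow_ext => /=.
apply/setP=> k; apply/imsetP/imsetP=> -[i iS ->].
  have [j jS' ij] : cset (chain_im x' S') (x i) by rewrite -SS'; exists i.
  by exists j => //; apply: rtE.
have [j jS ij] : cset (chain_im x S) (x' i) by rewrite SS'; exists i.
by exists j => //; apply/esym/rtE.
Qed.

Lemma chain_realize_ends (T : chain) m (x : {omorphism ord m -> E}) :
  (forall v, cset T v <-> exists i, x i = v) ->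
  x ord0 = csrc T /\ x ord_max = ctgt T.
Proof.
move=> xT.
have [[i xi] [j xj]] := ((xT _).1 (csrc_in T), (xT _).1 (ctgt_in T)).
have [x0 x1] : cset T (x ord0) /\ cset T (x ord_max).
  by split; apply/xT; [exists ord0|exists ord_max].
split; apply/le_anti.
  by rewrite (csrc_min x0) -xi omorph_le // le0x.
by rewrite (ctgt_max x1) -xj omorph_le // lex1.
Qed.

Lemma chain_incl_realize (a : chain_incl) :
  exists m (x : {omorphism ord m -> E}),
    (forall v, cset (ccod a) v <-> exists i, x i = v) /\
    exists c, chain_incl_im x c = a.
Proof.
have [m [x xa]] := chain_realize (ccod a); exists m, x; split=> //.
have [x0 x1] := chain_realize_ends xa.
have [|||c [_ _ xc]] := @chain_incl_restr m x ord0 ord_max a (le0x _).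
- by rewrite x0 cincl_src.
- by rewrite x1 cincl_tgt.
- by move=> v /xa.
by exists c.
Qed.

(** The simplex realizes the largest of the three chains. A single lift [R] of the middle chain
    serves both as codomain of the first 2-arrow and as domain of the second. *)
Lemma chain_vcomp_realize (a b : chain_incl) : ccod a = cdom b ->
  exists m (x : {omorphism ord m -> E}) a' b',
    [/\ chain_incl_im x a' = a, chain_incl_im x b' = b & ocod a' = odom b'].
Proof.
move=> ab; have [m [x xb]] := chain_realize (ccod b).
have [x0 x1] := chain_realize_ends xb.
have x0' : x ord0 = csrc (ccod a) by rewrite x0 cincl_src ab.
have x1' : x ord_max = ctgt (ccod a) by rewrite x1 cincl_tgt ab.
have sub v : cset (ccod a) v -> exists i, x i = v.
  by rewrite ab => /cincl_sub /xb.
have [R [R0 R1 RE xR]] := chain_restr (le0x _) x0' x1' sub.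
have [|||S [S0 S1 SE xS]] := @chain_restr m x ord0 ord_max (cdom a) (le0x _).
- by rewrite x0' cincl_src.
- by rewrite x1' cincl_tgt.
- by move=> v /cincl_sub /sub.
have [|T [T0 T1 TE xT]] := @chain_restr m x ord0 ord_max (ccod b) (le0x _) x0 x1.
  by move=> v /xb.
unshelve eexists m, x, (@OCell m S R _ _ _), (@OCell m R T _ _ _);
  rewrite ?R0 ?S0 ?T0 ?R1 ?S1 ?T1 //.
- by rewrite RE SE; apply/chain_restr_sub/cincl_sub.
- by rewrite RE TE; apply: chain_restr_sub; rewrite ab; apply: cincl_sub.
by split=> //; apply: chain_incl_ext => //=; rewrite xR.
Qed.

(** The simplex realizes the composite of the two codomains. An index [k] over the common vertex is
    chosen, [a] being lifted between [ord0] and [k] and [b] between [k] and [ord_max]. *)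
Lemma chain_hcomp_realize (a b : chain_incl) : ctgt (cdom a) = csrc (cdom b) ->
  exists m (x : {omorphism ord m -> E}) a' b',
    [/\ chain_incl_im x a' = a, chain_incl_im x b' = b &
      otgt (odom a') = osrc (odom b')].
Proof.
move=> ab; have ab' := chain_hcomp_subproof ab.
have [m [x xab]] := chain_realize (chain_comp ab').
have [x0 x1] := chain_realize_ends xab.
have [k xk] : exists k, x k = ctgt (ccod a) by apply/xab; left; apply: ctgt_in.
have [|||a' [_ a1 xa]] := @chain_incl_restr m x ord0 k a (le0x _).
- by rewrite x0 /= cincl_src.
- by rewrite xk cincl_tgt.
- by move=> v av; apply/xab; left.
have [|||b' [b0 _ xb]] := @chain_incl_restr m x k ord_max b (lex1 _).
- by rewrite xk ab' cincl_src.
- by rewrite x1 /= cincl_tgt.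
- by move=> v bv; apply/xab; right.
by exists m, x, a', b'; rewrite a1 b0.
Qed.

Lemma chain_ar_realize (T : chain) :
  exists m (x : {omorphism ord m -> E}) S, chain_im x S = T.
Proof.
have [m [x [_ [c xc]]]] := chain_incl_realize (chain_id2 T).
by exists m, x, (odom c); apply: (congr1 cdom xc).
Qed.

Lemma chain_comp_realize (S T : chain) : ctgt S = csrc T ->
  exists m (x : {omorphism ord m -> E}) S' T',
    [/\ chain_im x S' = S, chain_im x T' = T & otgt S' = osrc T'].
Proof.
move=> ST; have [m [x [a [b [xa xb ab]]]]] :=
  @chain_hcomp_realize (chain_id2 S) (chain_id2 T) ST.
by exists m, x, (odom a), (odom b); split=> //;
  [apply: (congr1 cdom xa)|apply: (congr1 cdom xb)].
Qed.

Definition point (v : E) : {omorphism ord 0 -> E}.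
Proof.
refine (@Order.OrderMorphism.Pack _ _ _ _ (fun _ => v) _).
by constructor; constructor=> x y _; apply: lexx.
Defined.

(** * Extension of a simplicial map from the nerve to a 2-functor on chains *)

Section Extension.
Variables (D : twocat) (f : smap (nerve E) (N2 D)).

Notation F x := (f _ (x : nerve E _)).

Definition chains_ext_ob (v : E) : ob D := fob (F (point v)) ord0.

Lemma chains_ext_obE m (x : {omorphism ord m -> E}) k : fob (F x) k = chains_ext_ob (x k).
Proof.
have -> : chains_ext_ob (x k) = fob (F (omcomp x (const_simplex 0 k))) ord0.
  by congr (fob (F _) _); apply: omorphism_ext.
by rewrite (smap_nat f (const_simplex 0 k : {omorphism ord 0 -> ord m}) x).
Qed.

Lemma fce_omcomp m n (x : {omorphism ord n -> E}) (t : {omorphism ord m -> ord n})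
    (a : ocell m) :
  fce (F (omcomp x t)) a = fce (F x) (ocell_map t a).
Proof. by rewrite (smap_nat f t x). Qed.

(** This makes the extension well defined on 2-arrows. The images of [x] and [x'] may be
    incomparable, so both are compared with a simplex [e] whose image is exactly the codomain of the
    inclusion, hence contained in each of them. *)
Lemma fce_chain_incl_im m n (x : {omorphism ord m -> E})
    (x' : {omorphism ord n -> E}) (c : ocell m) (c' : ocell n) :
  chain_incl_im x c = chain_incl_im x' c' -> fce (F x) c = fce (F x') c'.
Proof.
have [p [e [ea [b eb]]]] := chain_incl_realize (chain_incl_im x c).
have key q (y : {omorphism ord q -> E}) (a : ocell q) :
    chain_incl_im y a = chain_incl_im x c -> fce (F y) a = fce (F e) b.
  move=> ya; have [|r [t [yr yt rt]]] := @chain_im_lift _ _ y e.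
    move=> j; have : cset (ccod (chain_incl_im x c)) (e j) by apply/ea; exists j.
    by rewrite -ya => -[i _ ->]; exists i.
  (* Both simplices are reindexings of [y], so naturality of [f] brings the two 2-arrows into the
     oriental over [y], where they coincide. *)
  rewrite -yr -yt !fce_omcomp; congr fce.
  apply: ocell_ext; apply: rt.
    exact: (congr1 cdom (etrans ya (esym eb))).
  exact: (congr1 ccod (etrans ya (esym eb))).
by move=> xx'; rewrite !key.
Qed.

Lemma chains_ext_ce_exists (a : chain_incl) :
  exists b : ce D, forall m (x : {omorphism ord m -> E}) c,
    chain_incl_im x c = a -> fce (F x) c = b.
Proof.
have [p [e [_ [b eb]]]] := chain_incl_realize a.
by exists (fce (F e) b) => m x c xc; apply: fce_chain_incl_im; rewrite xc.
Qed.

Definition chains_ext_ce (a : chain_incl) : ce D := sval (cid (chains_ext_ce_exists a)).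
(** Going through identity 2-arrows reduces independence of the realization for arrows to the case
    of 2-arrows. *)
Definition chains_ext_ar (S : chain) : ar D := dom (chains_ext_ce (chain_id2 S)).

Lemma chains_ext_ceE m (x : {omorphism ord m -> E}) (c : ocell m) :
  fce (F x) c = chains_ext_ce (chain_incl_im x c).
Proof. by rewrite /chains_ext_ce; case: cid => b /= ->. Qed.

Lemma chains_ext_arE m (x : {omorphism ord m -> E}) S :
  far (F x) S = chains_ext_ar (chain_im x S).
Proof.
have -> : chains_ext_ar (chain_im x S) = dom (fce (F x) (oid2 S)).
  by rewrite chains_ext_ceE; congr (dom (chains_ext_ce _)); apply: chain_incl_ext.
by rewrite fce_dom.
Qed.

(** For each axiom the operands are realized, composably, in one simplex [x], where the axiom is the
    functoriality of the 2-functor [F x]. *)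
Definition chains_ext : twofun chains D.
Proof.
refine (@TwoFun chains D chains_ext_ob chains_ext_ar chains_ext_ce _ _ _ _ _ _ _ _ _).
- move=> T; have [m [x [S <-]]] := chain_ar_realize T.
  by rewrite -chains_ext_arE far_src chains_ext_obE.
- move=> T; have [m [x [S <-]]] := chain_ar_realize T.
  by rewrite -chains_ext_arE far_tgt chains_ext_obE.
- move=> a; have [m [x [_ [c <-]]]] := chain_incl_realize a.
  by rewrite -chains_ext_ceE fce_dom chains_ext_arE.
- move=> a; have [m [x [_ [c <-]]]] := chain_incl_realize a.
  by rewrite -chains_ext_ceE fce_cod chains_ext_arE.
- move=> v; have -> : id1 (v : ob chains) = chain_im (point v) (oid1 ord0).
    apply: chain_ext => w /=; split=> [->|[_ _ ->]] //.
    by exists ord0; rewrite ?inE.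
  by rewrite -chains_ext_arE (far_id1 (F (point v))).
- move=> S T e e'; have [m [x [S' [T' [xS xT ST]]]]] := chain_comp_realize e.
  subst S T; have -> : Defs.comp e = chain_im x (ocomp ST).
    exact/esym/chain_im_comp.
  rewrite -chains_ext_arE (@far_comp _ _ (F x) _ _ ST); first by rewrite !chains_ext_arE.
  by move=> e''; apply: comp_eq; rewrite chains_ext_arE.
- move=> T; have [m [x [S <-]]] := chain_ar_realize T.
  have -> : id2 (chain_im x S : ar chains) = chain_incl_im x (oid2 S).
    exact: chain_incl_ext.
  by rewrite -chains_ext_ceE -chains_ext_arE (fce_id2 (F x)).
- move=> a b e e'; have [m [x [a' [b' [xa xb ab]]]]] := chain_vcomp_realize e.
  subst a b; have -> : vcomp e = chain_incl_im x (ovcomp ab).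
    exact: chain_incl_ext.
  rewrite -chains_ext_ceE (@fce_vcomp _ _ (F x) _ _ ab); first by rewrite !chains_ext_ceE.
  by move=> e''; apply: vcomp_eq; rewrite chains_ext_ceE.
- move=> a b e e'; have [m [x [a' [b' [xa xb ab]]]]] := chain_hcomp_realize e.
  subst a b; have -> : hcomp e = chain_incl_im x (ohcomp ab).
    by apply: chain_incl_ext; apply: esym; apply: chain_im_comp.
  rewrite -chains_ext_ceE (@fce_hcomp _ _ (F x) _ _ ab); first by rewrite !chains_ext_ceE.
  by move=> e''; apply: hcomp_eq; rewrite chains_ext_ceE.
Defined.

Lemma chains_ext_unit : smap_comp (N2_map chains_ext) chains_unit = f.
Proof.
apply: smap_ext => n x; apply: twofun_ext => a /=.
- by rewrite chains_ext_obE.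
- by rewrite chains_ext_arE.
- by rewrite chains_ext_ceE.
Qed.

End Extension.

(** * The deformation of N_2 of the chains onto the nerve *)

Definition oedge m (i j : ord m) (ij : i <= j) : oarrow m.
Proof.
by apply: (@OArrow m i j [set i; j]) => [||k|k];
  rewrite !inE ?eqxx ?orbT // => /orP[] /eqP->.
Defined.

(** Turns a nonempty intersection [oset S :&: A] into an arrow, to which a 2-functor can be
    applied. *)
Lemma oarrow_of_set m (B : {set ord m}) i :
  i \in B -> exists R : oarrow m, oset R = B.
Proof.
move=> iB.
have [k kB kmin] := @arg_minnP _ i (mem B) val iB.
have [l lB lmax] := @arg_maxnP _ i (mem B) val iB.
by exists (@OArrow m k l B kB lB kmin lmax).
Qed.

Section Prism.
Variables (m : nat) (y : twofun (oriental m) chains).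

Lemma fob_homo : {homo (fob y : ord m -> E) : i j / i <= j}.
Proof.
move=> i j ij; have := csrc_le_ctgt (far y (oedge ij)).
by have /= -> := far_src y (oedge ij); have /= -> := far_tgt y (oedge ij).
Qed.

Lemma cset_far_sub (R R' : oarrow m) v : osrc R' = osrc R -> otgt R' = otgt R ->
  oset R \subset oset R' -> cset (far y R) v -> cset (far y R') v.
Proof.
move=> s t RR'; pose c := OCell s t RR'.
have := @cincl_sub (fce y c) v.
by have /= -> := fce_dom y c; have /= -> := fce_cod y c.
Qed.

Lemma cset_far_comp (R R' : oarrow m) (e : otgt R = osrc R') v :
  cset (far y (ocomp e)) v <-> cset (far y R) v \/ cset (far y R') v.
Proof.
have e' : ctgt (far y R) = csrc (far y R').
  by have /= -> := far_tgt y R; have /= -> := far_src y R'; rewrite e.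
by have /= -> := @far_comp _ _ y R R' e e'.
Qed.

(** The ends of [R] and [R'] may differ. Composing [R] with the edges joining its ends to those of
    [R'] gives an arrow parallel to [R'] and included in it, whose image contains that of [R]. *)
Lemma cset_far_mono (R R' : oarrow m) v :
  oset R \subset oset R' -> cset (far y R) v -> cset (far y R') v.
Proof.
move=> /subsetP RR' vR.
have s : osrc R' <= osrc R by apply/osrc_min/RR'/osrc_in.
have t : otgt R <= otgt R' by apply/otgt_max/RR'/otgt_in.
have e2 : otgt R = osrc (oedge t) by [].
have e1 : otgt (oedge s) = osrc (ocomp e2) by [].
apply: (@cset_far_sub (ocomp e1)) => //=; last first.
  by apply/cset_far_comp; right; apply/cset_far_comp; left.
apply/subsetP=> i; rewrite !inE => /or3P[/orP[]/eqP->|/RR' //|/orP[]/eqP->].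
- exact: osrc_in.
- exact/RR'/osrc_in.
- exact/RR'/otgt_in.
- exact: otgt_in.
Qed.

Lemma csrc_far R : csrc (far y R) = fob y (osrc R).
Proof. exact: (far_src y R). Qed.

Lemma ctgt_far R : ctgt (far y R) = fob y (otgt R).
Proof. exact: (far_tgt y R). Qed.

Lemma cset_far_id i v : cset (far y (oid1 i)) v <-> v = fob y i.
Proof. by have /= -> := far_id1 y i. Qed.

Lemma cset_far_vertex (R : oarrow m) i :
  i \in oset R -> cset (far y R) (fob y i).
Proof.
move=> iR; apply: (@cset_far_mono (oid1 i)); first by rewrite /= sub1set.
exact/cset_far_id.
Qed.

Variables (A : {set ord m}) (A_up : forall i j, i \in A -> i <= j -> j \in A).

(* The arrows of [y] are kept on the part of [S] lying in the upper set A and are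
   replaced by the minimal ones on the rest. *)
Definition prism_set (S : oarrow m) (v : E) :=
  (exists2 i, i \in oset S & v = fob y i) \/
  (exists2 R : oarrow m, oset R = oset S :&: A & cset (far y R) v).

Definition prism_ar (S : oarrow m) : chain.
Proof.
apply: (@Chain (fob y (osrc S)) (fob y (otgt S)) (prism_set S)).
- by left; exists (osrc S) => //; apply: osrc_in.
- by left; exists (otgt S) => //; apply: otgt_in.
- move=> v [[i iS ->]|[R RE /csrc_min]]; first exact/fob_homo/osrc_min.
  apply: le_trans; rewrite csrc_far; apply/fob_homo/osrc_min.
  by have := osrc_in R; rewrite RE inE => /andP[].
- move=> v [[i iS ->]|[R RE /ctgt_max vR]]; first exact/fob_homo/otgt_max.
  apply: (le_trans vR); rewrite ctgt_far; apply/fob_homo/otgt_max.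
  by have := otgt_in R; rewrite RE inE => /andP[].
(* If [oset S] misses [A], no [R] exists and only the vertices remain; otherwise [R] is determined
   by its set, so a single finite list bounds its image. *)
- have [[R RE]|noR] := pselect (exists R : oarrow m, oset R = oset S :&: A).
    have [s Rs] := cset_finite (far y R).
    exists (codom (fob y : ord m -> E) ++ s) => v; rewrite mem_cat.
    case=> [[i _ ->]|[R' R'E]]; first by rewrite codom_f.
    have -> : R' = R by apply: oarrow_ext; rewrite R'E.
    by move=> /Rs ->; rewrite orbT.
  exists (codom (fob y : ord m -> E)) => v [[i _ ->]|[R RE]].
    exact: (codom_f (fob y : ord m -> E)).
  by case: noR; exists R.
(* A vertex indexed in [A] belongs to the chain [far y R]; one indexed outside [A] precedes
   [osrc R], because [A] is an upper set, and so lies below that whole chain. *)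
- have mixed i (R : oarrow m) v : i \in oset S -> oset R = oset S :&: A ->
      cset (far y R) v -> (fob y i : E) >=< v.
    move=> iS RE vR; have [iA|iA] := boolP (i \in A).
      by apply: cset_total vR; apply: cset_far_vertex; rewrite RE inE iS.
    apply/le_comparable/(le_trans _ (csrc_min vR)); rewrite csrc_far.
    apply: fob_homo; case/orP: (le_total i (osrc R)) => // Ri.
    have := osrc_in R; rewrite RE inE => /andP[_ RA].
    by rewrite (A_up RA Ri) in iA.
  move=> v w [[i iS ->]|[R RE vR]] [[j jS ->]|[R' R'E wR]].
  + by case/orP: (le_total i j) => /fob_homo; [exact: le_comparable|exact: ge_comparable].
  + exact: mixed R'E wR.
  + by rewrite comparable_sym; apply: mixed RE vR.
  + have eR : R' = R by apply: oarrow_ext; rewrite R'E.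
    by apply: cset_total vR _; rewrite -eR.
Defined.

Lemma prism_ar_mono (S T : oarrow m) v :
  oset S \subset oset T -> cset (prism_ar S) v -> cset (prism_ar T) v.
Proof.
move=> ST [[i iS ->]|[R RE vR]].
  by left; exists i => //; apply: (subsetP ST).
have [|R' R'E] := @oarrow_of_set m (oset T :&: A) (osrc R).
  by apply/(subsetP (setSI A ST)); rewrite -RE; apply: osrc_in.
by right; exists R' => //; apply: cset_far_mono vR; rewrite RE R'E setSI.
Qed.

Definition prism_ce (a : ocell m) : chain_incl.
Proof.
apply: (@ChainIncl (prism_ar (odom a)) (prism_ar (ocod a))) => /=.
- by rewrite ocell_src.
- by rewrite ocell_tgt.
- by move=> v; apply/prism_ar_mono/ocell_sub.
Defined.

(** If the middle vertex is outside [A], then [S] misses [A] and the kept part comes from [T] alone.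
    If it is in [A], all of [T] is in [A], and the kept part is the composite of that of [S] with
    [T], which [y] preserves. *)
Lemma prism_ar_comp S T e e' :
  prism_ar (@ocomp m S T e) = @chain_comp (prism_ar S) (prism_ar T) e'.
Proof.
apply: chain_ext => v; split; last first.
  by case; apply: prism_ar_mono; [apply: subsetUl|apply: subsetUr].
case=> [[i] /= |[R /= RE vR]].
  by rewrite inE => /orP[iS|iT] ->; left + right; left; exists i.
have [kA|kA] := boolP (otgt S \in A); last first.
  right; right; exists R => //; rewrite RE setIUl.
  apply/setUidPr/subsetP=> i; rewrite inE => /andP[/otgt_max iS iA].
  by rewrite (A_up iA iS) in kA.
have TA : oset T = oset T :&: A.
  apply/esym/setIidPl/subsetP=> i /osrc_min; rewrite -e; exact: A_up.
have [|R' R'E] := @oarrow_of_set m (oset S :&: A) (otgt S).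
  by rewrite inE otgt_in.
have e'' : otgt R' = osrc T.
  rewrite -e; apply/le_anti/andP; split; last first.
    by apply: otgt_max; rewrite R'E inE otgt_in.
  by apply: otgt_max; have := otgt_in R'; rewrite R'E inE => /andP[].
have RE' : R = ocomp e''.
  by apply: oarrow_ext; rewrite /= RE R'E setIUl -TA.
by move: vR; rewrite RE' => /cset_far_comp[vR|vT]; [left; right; exists R'
  |right; right; exists T].
Qed.

Definition prism : N2 chains m.
Proof.
refine (@TwoFun (oriental m) chains (fob y) prism_ar prism_ce
  _ _ _ _ _ _ _ _ _) => //.
- move=> k; apply: chain_ext => v; split=> [[[i]|[R RE vR]]|->].
  + by rewrite inE => /eqP ->.
  + have kR i : i \in oset R -> i = k by rewrite RE !inE => /andP[/eqP].
    apply/cset_far_id; apply: cset_far_mono vR.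
    by apply/subsetP=> i /kR ->; rewrite inE.
  + by left; exists k; rewrite ?inE.
- exact: prism_ar_comp.
- by move=> *; apply: chain_incl_ext.
- by move=> *; apply: chain_incl_ext.
- by move=> *; apply: chain_incl_ext; apply: prism_ar_comp.
Defined.

End Prism.

Definition vertices m (y : N2 chains m) : {omorphism ord m -> E}.
Proof.
refine (@Order.OrderMorphism.Pack _ _ _ _ (fob y) _).
by constructor; constructor; apply: fob_homo.
Defined.

Definition chains_retraction : smap (N2 chains) (nerve E).
Proof.
refine (@SMap (N2 chains) (nerve E) vertices _).
by move=> m n f y; apply: omorphism_ext.
Defined.

Lemma chains_retractionK : smap_comp chains_retraction chains_unit = smap_id (nerve E).
Proof. by apply: smap_ext => n x; apply: omorphism_ext. Qed.

Definition top_part m (a : {omorphism ord m -> ord 1}) := [set i | a i == ord_max].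

Lemma top_part_up m (a : {omorphism ord m -> ord 1}) i j :
  i \in top_part a -> i <= j -> j \in top_part a.
Proof.
rewrite !inE => /eqP ai ij; apply/eqP/le_anti.
by rewrite lex1 -ai omorph_le.
Qed.

Definition chains_homotopy : smap (sprod (N2 chains) (stdsimplex 1)) (N2 chains).
Proof.
refine (@SMap (sprod (N2 chains) (stdsimplex 1)) (N2 chains)
  (fun m z => prism z.1 (@top_part_up m z.2)) _).
move=> m n f [y a]; have prismE S :
    prism_ar (twofun_comp y (oriental_map f)) (@top_part_up m (omcomp a f)) S =
    prism_ar y (@top_part_up n a) (oarrow_map f S).
  (* Naturality rests on the projection formula for the image of an intersection with a preimage. *)
  have top_map : f @: (oset S :&: top_part (omcomp a f)) =
      f @: oset S :&: top_part a.
    apply/setP=> k; rewrite inE; apply/imsetP/andP=> [[i + ->]|[/imsetP[i iS ->] ka]].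
      by rewrite !inE => /andP[iS ia]; rewrite imset_f.
    by exists i => //; rewrite inE iS; rewrite !inE in ka *.
  apply: chain_ext => v; split=> [[[i iS ->]|[R RE vR]]|[[_ /imsetP[i iS ->] ->]|[R RE vR]]].
  - by left; exists (f i); rewrite ?imset_f.
  - by right; exists (oarrow_map f R) => //=; rewrite RE.
  - by left; exists i.
  (* The source of [R] shows that the part of [S] over the top vertex is nonempty, so it underlies
     an arrow [R'], which [f] maps onto [R]. *)
  - have := osrc_in R; rewrite RE -top_map => /imsetP[i iSA _].
    have [R' R'E] := oarrow_of_set iSA.
    right; exists R' => //=.
    suff -> : oarrow_map f R' = R by [].
    by apply: oarrow_ext; rewrite /= R'E top_map RE.
by apply: twofun_ext => //= c; apply: chain_incl_ext; apply: prismE.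
Defined.

(** At the end [ord0] the upper set is empty and only the vertices are left; at [ord_max] it is
    everything, and [R] = [S] gives back the arrows of [y]. *)
Lemma chains_deformation :
  elementary_homotopy (smap_comp chains_unit chains_retraction) (smap_id (N2 chains)).
Proof.
exists chains_homotopy => n y; split.
- have prismE S : prism_ar y (@top_part_up n (const_simplex n (@ord0 1))) S =
      chain_im (vertices y) S.
    apply: chain_ext => v; split=> [[//|[R RE _]]|]; last by left.
    by have := osrc_in R; rewrite RE !inE => /andP[_ /eqP].
  by apply: twofun_ext => //= c; apply: chain_incl_ext; apply: prismE.
- have prismE S : prism_ar y (@top_part_up n (const_simplex n (@ord_max 1))) S =
      far y S.
    apply: chain_ext => v; split=> [[[i iS ->]|[R RE]]|vS].
    + exact: cset_far_vertex.
    + by apply: cset_far_mono; rewrite RE subsetIl.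
    + right; exists S => //; apply/esym/setIidPl/subsetP=> i _.
      by rewrite !inE.
  apply: twofun_ext => //= c; apply: chain_incl_ext; rewrite /= prismE; apply: esym.
    exact: (fce_dom y c).
  exact: (fce_cod y c).
Qed.

End Chains.

(** * Transfer of the deformation from the chains to c_2 N(E) *)

Theorem mainTheorem7 (c2 : left_adjoint_N2) (d : Order.disp_t)
  (E : porderType d) : weak_equivalence (adj_unit c2 (nerve E)).
Proof.
set eta := adj_unit c2 (nerve E).
have [F [Feta _]] := adj_unit_universal c2 (chains_unit E).
pose G := chains_ext eta; have Geta := chains_ext_unit eta.
(* Both 2-functors carry [eta] to itself, so the uniqueness part of its universal property
   identifies them. *)
have GF : twofun_comp G F = twofun_id _.
  have [H [_ Huniq]] := adj_unit_universal c2 eta.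
  rewrite -(Huniq (twofun_comp G F)); last by rewrite N2_map_comp -smap_compA Feta.
  apply: Huniq; apply: smap_ext => n x; exact: twofun_ext.
apply: (@deformation_retract_weak_equivalence _ _ _
  (smap_comp (chains_retraction E) (N2_map F))).
  by rewrite -smap_compA Feta chains_retractionK.
(* The two maps to be compared become the ends of [chains_deformation], composed with [N2_map G] on
   the left and [N2_map F] on the right. *)
have -> : smap_id (N2 (ladj c2 (nerve E))) =
    smap_comp (smap_comp (N2_map G) (smap_id (N2 (chains E)))) (N2_map F).
  rewrite (_ : smap_comp (N2_map G) _ = N2_map G); last exact: smap_ext.
  by rewrite -N2_map_comp GF; apply: smap_ext => n x; apply: twofun_ext.
rewrite -[in smap_comp eta _]Geta smap_compA -(smap_compA _ (chains_unit E)).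
apply: homotopic_compr; apply: homotopic_compl; apply: rst_step.
exact: chains_deformation.
Qed.
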